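(* Assume directional finite curvature at $\mathbf{u}\in S^{d-1}$: there is a constant $C>0$ such that for any $\mathbf{u}^{\perp}\in\mathrm{span}\{\tilde{\mathbf{u}}_2,\dots,\tilde{\mathbf{u}}_d\}$, $\mu(\mathbf{u}+\mathbf{u}^{\perp})-\mu(\mathbf{u})\le C|\mathbf{u}^{\perp}|^2$. Then for any $\varepsilon>0$ with $\overline{\chi}:=\overline{\chi}_{\mathrm{u}}(\mathbf{u})+\varepsilon<1$, there exist $\theta_0>0$ and $c_0>0$ such that, if $K$ is large enough, then for any $a\in[\overline{\chi},1]$ and any $\mathbf{v}\in H_{\mathbf{u}}$ with $|K\mathbf{v}-K\mathbf{u}|<K^{\frac{\overline{\chi}+1+c_0}{2}}$, $$\mathbb{P}\Big(T_{\mathrm{Cyl}_{\mathbf{v}}([-2K,2K],K^{\frac{a+1}{2}})}(\mathbf{0},K\mathbf{v})>K\mu(\mathbf{v})+K^{a}\Big)\le e^{-K^{\theta_0(a-\overline{\chi})}}.$$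
   Context: First-passage percolation setting. Let $d\ge2$. To each nearest-neighbor edge $e$ of $\mathbb{Z}^d$ assign a nonnegative random weight $\tau_e$; the $(\tau_e)$ are i.i.d., nondegenerate, satisfy $\mathbb{P}(\tau_e=0)<p_c(d)$ (the critical probability of Bernoulli bond percolation on $\mathbb{Z}^d$), and are bounded: $\mathbb{P}(\tau_e\le C)=1$ for some $C>0$. For a lattice path $\gamma$ put $T(\gamma)=\sum_{e\in\gamma}\tau_e$. For $\mathbf{x},\mathbf{y}\in\mathbb{Z}^d$, $T(\mathbf{x},\mathbf{y})=\inf_{\gamma:\mathbf{x}\to\mathbf{y}}T(\gamma)$; for $\mathbf{x},\mathbf{y}\in\mathbb{R}^d$, $T(\mathbf{x},\mathbf{y}):=T(\lfloor\mathbf{x}\rfloor,\lfloor\mathbf{y}\rfloor)$, where $\lfloor\mathbf{x}\rfloor$ is the unique point of $\mathbb{Z}^d$ with $\mathbf{x}\in\lfloor\mathbf{x}\rfloor+[0,1)^d$. For $A\subset\mathbb{R}^d$, $T_A(\mathbf{x},\mathbf{y})$ is the infimum of $T(\gamma)$ over lattice paths $\gamma$ contained in $A$ from $\lfloor\mathbf{x}\rfloor$ to $\lfloor\mathbf{y}\rfloor$. The time constant $\mu$ is the norm on $\mathbb{R}^d$ determined by $\mu(\mathbf{x})=\lim_{N\to\infty}T(\mathbf{0},N\mathbf{x})/N$ (a.s. and in $L^1$) for $\mathbf{x}\in\mathbb{Z}^d$, and $\mathbb{B}_d=\{\mathbf{x}\in\mathbb{R}^d:\mu(\mathbf{x})\le1\}$.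 $|\cdot|$ is the Euclidean norm and $S^{d-1}$ the Euclidean unit sphere. Fix $\mathbf{u}\in S^{d-1}$. $H_{\mathbf{u}}$ is a tangent (supporting) hyperplane at $\mathbf{u}$ to the boundary of $\mu(\mathbf{u})\mathbb{B}_d$ (ties broken by a predetermined rule), and $\{\tilde{\mathbf{u}}_1,\dots,\tilde{\mathbf{u}}_d\}$ is a fixed orthonormal basis of $\mathbb{R}^d$ with $\mathbf{u}+\mathrm{span}\{\tilde{\mathbf{u}}_2,\dots,\tilde{\mathbf{u}}_d\}=H_{\mathbf{u}}$ and $\tilde{\mathbf{u}}_1\cdot\mathbf{u}>0$. For $\mathbf{v}\in\mathbb{R}^d\setminus\{\mathbf{0}\}$, $I\subset\mathbb{R}$, $h>0$, the tilted cylinder is $$\mathrm{Cyl}_{\mathbf{v}}(I,h)=\Big\{y_1\mathbf{v}+\sum_{i=2}^dy_i\tilde{\mathbf{u}}_i:\ y_1\in I,\ |y_i|\le h\Big\}.$$ The upper fluctuation exponent (the subscript $\mathrm{u}$ stands for ''upper'') is $$\overline{\chi}_{\mathrm{u}}(\mathbf{u}):=\lim_{\delta\to0}\lim_{n\to\infty}\inf\Big\{\chi>0:\ \forall\mathbf{x}\in\mathbb{R}^d\text{ with }|\mathbf{x}|\ge n,\ \big|\mathbf{u}-\tfrac{\mathbf{x}}{|\mathbf{x}|}\big|<\delta,\ \mathbb{E}\big[(T_{\mathrm{Cyl}_{\mathbf{x}}(\mathbb{R},|\mathbf{x}|^{(1+\chi)/2})}(\mathbf{0},\mathbf{x})-\mu(\mathbf{x}))_+\big]\le|\mathbf{x}|^{\chi}\Big\}.$$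 *)

(* Defs.v *)
From HB Require Import structures.
From mathcomp Require Import all_boot all_order all_algebra.
From mathcomp Require Import all_classical all_reals all_analysis.

Set Implicit Arguments.
Unset Strict Implicit.
Unset Printing Implicit Defensive.

Import Order.TTheory GRing.Theory Num.Theory.
Import numFieldNormedType.Exports.

Local Open Scope classical_set_scope.
Local Open Scope ring_scope.

(** * Euclidean geometry *)

(* The norm [`|x|] that MathComp-Analysis puts on row vectors is the sup norm,
   hence a separate Euclidean norm. *)
Definition dot (R : realType) (d : nat) (x y : 'rV[R]_d) : R :=
  \sum_(i < d) x 0 i * y 0 i.

Definition enorm (R : realType) (d : nat) (x : 'rV[R]_d) : R :=
  Num.sqrt (dot x x).

Definition to_real (R : realType) (d : nat) (z : 'rV[int]_d) : 'rV[R]_d :=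
  map_mx intr z.

Definition floor_pt (R : realType) (d : nat) (x : 'rV[R]_d) : 'rV[int]_d :=
  map_mx Num.floor x.

Definition is_norm (R : realType) (d : nat) (mu : 'rV[R]_d -> R) : Prop :=
  [/\ forall x y, mu (x + y) <= mu x + mu y,
      forall a x, mu (a *: x) = `|a| * mu x
    & forall x, mu x = 0 -> x = 0].

Definition supporting_hyperplane (R : realType) (d : nat)
    (S : set 'rV[R]_d) (p : 'rV[R]_d) (H : set 'rV[R]_d) : Prop :=
  exists2 w : 'rV[R]_d, w != 0 &
    H = [set x | dot w x = dot w p] /\
    (forall x, S x -> dot w x <= dot w p).

Definition orthonormal_basis (R : realType) (d : nat)
    (ut : 'I_d -> 'rV[R]_d) : Prop :=
  forall i j, dot (ut i) (ut j) = (i == j)%:R.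

(* Indices start at 0: the vector called u~_1 in the mathematics has index 0,
   and u~_2, ..., u~_d are those of index i > 0. *)
Definition transverse_span (R : realType) (d : nat) (ut : 'I_d -> 'rV[R]_d) :
    {vspace 'rV[R]_d} :=
  <<[seq ut i | i : 'I_d <- enum 'I_d & (0 < i)%N]>>%VS.

Definition tilted_frame (R : realType) (d : nat) (u : 'rV[R]_d)
    (H : set 'rV[R]_d) (ut : 'I_d -> 'rV[R]_d) : Prop :=
  [/\ orthonormal_basis ut,
      [set u + t | t in [set t | t \in transverse_span ut]] = H
    & forall i : 'I_d, i = 0%N :> nat -> 0 < dot (ut i) u].

Definition Cyl (R : realType) (d : nat) (ut : 'I_d -> 'rV[R]_d)
    (v : 'rV[R]_d) (I : set R) (h : R) : set 'rV[R]_d :=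
  [set x | exists (y1 : R) (y : 'I_d -> R),
     [/\ I y1,
         forall i : 'I_d, (0 < i)%N -> `|y i| <= h
       & x = y1 *: v + \sum_(i < d | (0 < i)%N) y i *: ut i]].

(** * Lattice paths and passage times *)

(* The edge {z, z + e_i} of Z^d is encoded as the pair (z, i); every
   nearest-neighbor edge is represented exactly once. *)
Definition edge (d : nat) : Type := ('rV[int]_d * 'I_d)%type.

(* A lattice path is a starting point and a list of steps; the step (i, true)
   is + e_i and the step (i, false) is - e_i. *)
Definition step (d : nat) : Type := ('I_d * bool)%type.

Definition move (d : nat) (z : 'rV[int]_d) (s : step d) : 'rV[int]_d :=
  if s.2 then z + delta_mx 0 s.1 else z - delta_mx 0 s.1.

Definition step_edge (d : nat) (z : 'rV[int]_d) (s : step d) : edge d :=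
  (if s.2 then z else move z s, s.1).

Definition path_end (d : nat) (z : 'rV[int]_d) (p : seq (step d)) :
  'rV[int]_d := foldl (@move d) z p.

Definition path_vertices (d : nat) (z : 'rV[int]_d) (p : seq (step d)) :
  seq 'rV[int]_d := z :: scanl (@move d) z p.

Fixpoint path_edges (d : nat) (z : 'rV[int]_d) (p : seq (step d)) :
    seq (edge d) :=
  if p is s :: p' then step_edge z s :: path_edges (move z s) p' else [::].

Definition path_time (R : realType) (d : nat) (t : edge d -> R)
    (z : 'rV[int]_d) (p : seq (step d)) : R :=
  \sum_(e <- path_edges z p) t e.

(* For convex A, such as a cylinder, it is the same to ask that the vertices of
   a path or that its edges (as segments) lie in A.  The infimum is +oo when
   there is no path in A. *)
Definition passage_time (R : realType) (d : nat) (t : edge d -> R)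
    (A : set 'rV[R]_d) (x y : 'rV[R]_d) : \bar R :=
  ereal_inf [set (path_time t (floor_pt x) p)%:E | p in
    [set p | path_end (floor_pt x) p = floor_pt y /\
             forall z, z \in path_vertices (floor_pt x) p -> A (to_real R z)]].

(** * Random weights *)

Definition mutually_independent (R : realType) (disp disp' : measure_display)
    (Omega : measurableType disp) (T : measurableType disp')
    (P : probability Omega R) (I : choiceType) (X : I -> {RV P >-> T}) : Prop :=
  forall (s : seq I) (B : I -> set T),
    uniq s -> (forall i, measurable (B i)) ->
    P (\bigcap_(i in [set` s]) (X i @^-1` B i)) =
    (\prod_(i <- s) P (X i @^-1` B i))%E.

Definition identically_distributed (R : realType)
    (disp disp' : measure_display)
    (Omega : measurableType disp) (T : measurableType disp')
    (P : probability Omega R) (I : Type) (X : I -> {RV P >-> T}) : Prop :=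
  forall (i j : I) (B : set T), measurable B ->
    P (X i @^-1` B) = P (X j @^-1` B).

Definition nondegenerate_rv (R : realType) (disp : measure_display)
    (Omega : measurableType disp) (P : probability Omega R)
    (X : {RV P >-> R}) : Prop :=
  ~ exists c : R, P [set w | X w = c] = 1%E.

(** * Critical probability of Bernoulli bond percolation *)

Definition open_cluster (d : nat) (o : edge d -> bool) (z : 'rV[int]_d) :
    set 'rV[int]_d :=
  [set path_end z p | p in [set p | all o (path_edges z p)]].

(* The probability that the cluster of the origin is infinite depends only on
   the law of the configuration, so any probability space carrying an i.i.d.
   Bernoulli(p) configuration may be used. *)
Definition percolates (R : realType) (d : nat) (p : R) : Prop :=
  exists (disp : measure_display) (Omega : measurableType disp)
    (P : probability Omega R) (X : edge d -> {RV P >-> bool}),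
    [/\ mutually_independent X,
        forall e, P [set w | X e w = true] = p%:E
      & (0 < P [set w | infinite_set (open_cluster (fun e => X e w) 0)])%E].

Definition p_c (R : realType) (d : nat) : R :=
  inf [set p : R | 0 <= p <= 1 /\ percolates d p].

(** * Time constant and upper fluctuation exponent *)

Section fpp.
Context (R : realType) (d : nat) (disp : measure_display).
Context (Omega : measurableType disp) (P : probability Omega R).
Variable tau : edge d -> {RV P >-> R}.

Definition T_in (A : set 'rV[R]_d) (x y : 'rV[R]_d) (w : Omega) : \bar R :=
  passage_time (fun e => tau e w) A x y.

Definition rescaled_time (x : 'rV[R]_d) (N : nat) (w : Omega) : \bar R :=
  (T_in setT 0 (N%:R *: x) w * (N%:R^-1)%:E)%E.

Definition time_constant (mu : 'rV[R]_d -> R) : Prop :=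
  is_norm mu /\
  forall z : 'rV[int]_d, let x := to_real R z in
    {ae P, forall w, rescaled_time x N w @[N --> \oo] --> (mu x)%:E} /\
    (\int[P]_w `|rescaled_time x N w - (mu x)%:E|)%E @[N --> \oo] --> 0%E.

Definition expected_excess (mu : 'rV[R]_d -> R) (A : set 'rV[R]_d)
    (x : 'rV[R]_d) : \bar R :=
  (\int[P]_w maxe (T_in A 0%R x w - (mu x)%:E) 0)%E.

Definition chi_upper_admissible (mu : 'rV[R]_d -> R) (u : 'rV[R]_d)
    (ut : 'I_d -> 'rV[R]_d) (delta : R) (n : nat) : set R :=
  [set chi | 0 < chi /\
     forall x : 'rV[R]_d,
       n%:R <= enorm x -> enorm (u - (enorm x)^-1 *: x) < delta ->
       (expected_excess mu (Cyl ut x setT (enorm x `^ ((1 + chi) / 2))%R) x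
        <= (enorm x `^ chi)%R%:E)%E].

(* The exponent lives in the extended reals because the infimum of an empty
   set of admissible exponents is +oo; both limits are monotone. *)
Definition chi_upper (mu : 'rV[R]_d -> R) (u : 'rV[R]_d)
    (ut : 'I_d -> 'rV[R]_d) : \bar R :=
  lim ((lim (ereal_inf (EFin @` chi_upper_admissible mu u ut delta n)
             @[n --> \oo])) @[delta --> 0^'+]).

End fpp.

(* Main.v *)
(* It is enough to treat a = chibar, since both the cylinder and the time
   allowance grow with a, and to bound the probability by exp(-K^th) for some
   fixed th > 0.  Fix an admissible exponent chi1 < chibar.

   By Markov's inequality, the passage time between 0 and L v in the infinite
   cylinder exceeds L mu(v) + L^(chi1+e) with probability O(L^-e).  A path of
   time O(L) in that cylinder travels only a distance O(L) along the axis: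
   cutting the cylinder into slabs as thick as it is wide, fast crossings of
   distinct slabs are independent, and each is unlikely by the law of large
   numbers applied to a finite mesh of pairs of points.  So the same bound holds
   in a cylinder of length O(L).

   Now cut the segment from 0 to K v into m ~ K^eta translated pieces of length
   L = K/m.  Pieces far enough apart are independent, so except with probability
   exp(-K^eta') at most O(K^eta') of them have excess above L^(chi1+e); if every
   piece has excess at most L^b up to a stretched exponential error, the total
   excess is at most K^(b(1-eta/2)) as long as this exponent is above chibar.
   Starting from the deterministic bound b = 2, finitely many such steps bring
   b down to chibar. *)

Require Import Defs.
From mathcomp Require Import all_boot all_order all_algebra.
From mathcomp Require Import all_classical all_reals all_analysis.
From mathcomp Require Import measurable_realfun.
From mathcomp Require Import ring lra zify.
Import Order.TTheory GRing.Theory Num.Theory.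
Import numFieldNormedType.Exports.
Local Open Scope classical_set_scope.
Local Open Scope ring_scope.
Set Implicit Arguments.
Unset Strict Implicit.
Unset Printing Implicit Defensive.

(** * Events depending on a set of edges *)

Section weights.
Context (R : realType) (d : nat).

(** The condition on [v] at scale [K] is not inherited by the shorter pieces, so every estimate is
    uniform over a fixed neighborhood [near_dir] of [u] in the hyperplane, and one [v] serves at all
    scales. Uniformity is also why the law of large numbers enters through finitely many lattice
    displacements: a limit along [v] itself would come without control in [v]. Pieces are moved by
    multiples of the lattice vector [floor_pt (L *: v)], which makes them exact translates with a
    common law. The rounding errors add up to a drift of order [m], harmless because [m] is about
    [K^eta] with [eta] below [chibar]. The gap between [chi1] and [chibar] pays for the losses: the
    Markov bound gives up [L^e] and summing [m] typical excesses adds [eta] to the exponent, so [e]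
    and [eta] are small compared with that gap. Since infima over paths need not be attained,
    probabilities are taken of events that some path has time at most [s]. They live on
    configurations [edge d -> R], where disjoint edge sets give independent sigma-algebras and a
    lattice shift is a relabelling of edges. *)

Definition box (s : seq (edge d)) (Y : edge d -> set R) : set (edge d -> R) :=
  [set t | forall e, e \in s -> Y e (t e)].

Definition boxes (S : set (edge d)) : set (set (edge d -> R)) :=
  [set B | exists s Y, [/\ forall e, e \in s -> S e, forall e, measurable (Y e)
     & B = box s Y]].

Definition sig (S : set (edge d)) := <<s boxes S >>.

Lemma boxes_setI S : setI_closed (boxes S).
Proof.
move=> _ _ [s [Y [sS mY ->]]] [s' [Y' [sS' mY' ->]]].
exists (s ++ s'), (fun e => (if e \in s then Y e else setT) `&`
  (if e \in s' then Y' e else setT)); split.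
- by move=> e; rewrite mem_cat => /orP[/sS|/sS'].
- by move=> e; apply: measurableI; case: ifP.
- apply/seteqP; split=> [t [H1 H2] e _|t H].
    by split; case: ifPn => // es; [exact: H1|exact: H2].
  split=> e es; have := H e; rewrite mem_cat es ?orbT => /(_ isT) [] //.
Qed.

Lemma sig_mono S S' : S `<=` S' -> sig S `<=` sig S'.
Proof.
move=> SS'; apply: sub_sigma_algebra2 => _ [s [Y [sS mY ->]]].
by exists s, Y; split=> // e /sS /SS'.
Qed.

Definition wtype (S : set (edge d)) := g_sigma_algebraType (boxes S).

Lemma sigE S (B : set (wtype S)) : measurable B = sig S B.
Proof. by []. Qed.

Lemma measurable_coord (S : set (edge d)) e : S e ->
  measurable_fun setT (fun t : wtype S => t e).
Proof.
move=> Se _ Y mY; rewrite setTI; apply: sub_sigma_algebra.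
exists [:: e], (fun=> Y); split=> //; first by move=> e'; rewrite inE => /eqP ->.
apply/seteqP; split=> [t Yt e'|t]; first by rewrite inE => /eqP ->.
by move=> /(_ e); apply; rewrite inE.
Qed.

Lemma measurable_path_time (S : set (edge d)) z p :
  (forall e, e \in path_edges z p -> S e) ->
  measurable_fun setT (fun t : wtype S => path_time t z p).
Proof.
rewrite /path_time; elim: (path_edges z p) => [|e s IH] H.
  apply: (eq_measurable_fun (fun _ : wtype S => 0 : R)) => [t _|]; first by rewrite big_nil.
  exact: measurable_cst.
apply: (eq_measurable_fun (fun t : wtype S => t e + (\sum_(i <- s) t i : R))).
  by move=> t _; rewrite big_cons.
apply: measurable_funD.
  by apply: measurable_coord; apply: H; rewrite inE eqxx.
by apply: IH => e' e's; apply: H; rewrite inE e's orbT.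
Qed.

Definition fast (W : set ('rV[int]_d * seq (step d))) (s : R) (t : edge d -> R) :=
  exists2 zp, W zp & path_time t zp.1 zp.2 <= s.

(** A path is a starting point with a list of steps, hence an element of a countable type, so this
    is a countable union of path events whatever [W] is. *)
Lemma sig_fast S W s :
  (forall zp e, W zp -> e \in path_edges zp.1 zp.2 -> S e) ->
  sig S [set t | fast W s t].
Proof.
move=> WS; rewrite -sigE.
rewrite (_ : mkset _ = \bigcup_(zp : 'rV[int]_d * seq (step d))
   [set t : wtype S | W zp /\ path_time t zp.1 zp.2 <= s]); last first.
  apply/seteqP; split=> [t [zp Wzp ts]|t [zp _ [Wzp ts]]]; exists zp => //.
apply: countable_bigcupT_measurable; first exact: countableP.
move=> zp; have [Wzp|nW] := pselect (W zp); last first.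
  rewrite (_ : mkset _ = set0) //.
  by apply/seteqP; split=> // t [].
rewrite (_ : mkset _ = [set t : wtype S | path_time t zp.1 zp.2 <= s]); last first.
  by apply/seteqP; split=> t // [].
have := @measurable_path_time S zp.1 zp.2 (fun e => WS zp e Wzp).
move=> /(_ measurableT `]-oo, s]%classic (measurable_itv _)).
rewrite setTI; congr measurable.
Qed.

End weights.

(** * Independence and relabelling invariance of weight events *)

Section pr.
Context (R : realType) (d : nat) (disp : measure_display).
Context (Omega : measurableType disp) (P : probability Omega R).
Variable tau : edge d -> {RV P >-> R}.

Definition env (w : Omega) : edge d -> R := fun e => tau e w.

Lemma measurable_box s Y : (forall e, measurable (Y e)) ->
  measurable (env @^-1` (box s Y)).
Proof.
move=> mY; rewrite (_ : _ @^-1` _ = \big[setI/setT]_(e <- s) (tau e @^-1` Y e)).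
  elim: s => [|e s IH]; first by rewrite big_nil.
  rewrite big_cons; apply: measurableI => //.
  rewrite -[X in measurable X]setTI; exact: measurable_funPT.
rewrite -bigcap_seq; apply/seteqP; split=> w H e es; exact: H.
Qed.

Lemma measurable_env B : sig setT B -> measurable (env @^-1` B).
Proof.
move: B; rewrite /sig; apply: smallest_sub; last first.
  by move=> _ [s [Y [_ mY ->]]]; exact: measurable_box.
split=> /=; first by rewrite preimage_set0; exact: measurable0.
- move=> A mA; rewrite setTD preimage_setC; exact: measurableC.
- move=> F mF; rewrite preimage_bigcup; exact: bigcupT_measurable.
Qed.

Definition pr (B : set (edge d -> R)) : R := fine (P (env @^-1` B)).

Lemma EFin_pr B : sig setT B -> (pr B)%:E = P (env @^-1` B).
Proof. by move=> mB; rewrite fineK// fin_num_measure//; exact: measurable_env. Qed.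

Lemma pr_ge0 B : 0 <= pr B.
Proof. exact: fine_ge0. Qed.

Lemma pr_mono B B' : sig setT B -> sig setT B' -> B `<=` B' -> pr B <= pr B'.
Proof.
move=> mB mB' BB'; rewrite -lee_fin !EFin_pr//; apply: le_measure.
- by rewrite inE; exact: measurable_env.
- by rewrite inE; exact: measurable_env.
- by move=> w; exact: BB'.
Qed.

Lemma pr_le1 B : sig setT B -> pr B <= 1.
Proof.
by move=> mB; rewrite -lee_fin EFin_pr//; apply: probability_le1; exact: measurable_env.
Qed.

Lemma sigU S (B B' : set (edge d -> R)) : sig S B -> sig S B' -> sig S (B `|` B').
Proof. exact: (@measurableU _ (wtype R S)). Qed.

Lemma sigI S (B B' : set (edge d -> R)) : sig S B -> sig S B' -> sig S (B `&` B').
Proof. exact: (@measurableI _ (wtype R S)). Qed.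

Lemma sigC S (B : set (edge d -> R)) : sig S B -> sig S (~` B).
Proof. exact: (@measurableC _ (wtype R S)). Qed.

Lemma sigT S : sig S [set: edge d -> R].
Proof. exact: (@measurableT _ (wtype R S)). Qed.

Lemma sig_bigI S (I : choiceType) (s : seq I) (F : I -> set (edge d -> R)) :
  (forall i, i \in s -> sig S (F i)) -> sig S (\bigcap_(i in [set` s]) F i).
Proof.
move=> mF; rewrite bigcap_seq big_seq; elim/big_ind: _ => //; first exact: sigT.
by move=> ? ?; exact: sigI.
Qed.

Lemma pr_setU B B' : sig setT B -> sig setT B' -> pr (B `|` B') <= pr B + pr B'.
Proof.
move=> mB mB'; rewrite -lee_fin EFinD !EFin_pr//; last exact: sigU.
by apply: measureU2; exact: measurable_env.
Qed.

Lemma pr_union_bound (I : choiceType) (s : seq I) (F : I -> set (edge d -> R)) B b :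
  sig setT B -> (forall i, i \in s -> sig setT (F i)) ->
  (forall i, i \in s -> pr (F i) <= b) ->
  B `<=` \bigcup_(i in [set` s]) F i -> pr B <= (size s)%:R * b.
Proof.
move=> mB; elim: s B mB => [|i s IH] B mB mF bF BF /=.
  rewrite mul0r (_ : B = set0) ?/pr ?preimage_set0 ?measure0//.
  by rewrite -subset0 => t /BF [].
have mD : sig setT (B `\` F i).
  by rewrite setDE; apply: sigI => //; apply: sigC; apply: mF; exact: mem_head.
apply: (@le_trans _ _ (pr (F i `|` (B `\` F i)))).
  apply: pr_mono => //; first by apply: sigU => //; apply: mF; exact: mem_head.
  by move=> t Bt; have [|] := pselect (F i t); [left|right].
apply: le_trans (pr_setU _ _) _ => //; first by apply: mF; exact: mem_head.
rewrite mulrSr addrC mulrDl mul1r lerD //; last by apply: bF; exact: mem_head.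
apply: IH => // [j js|j js|t [/BF[j]]]; first by apply: mF; rewrite inE js orbT.
  by apply: bF; rewrite inE js orbT.
by rewrite /= inE => /orP[/eqP ->//|js Fj _]; exists j.
Qed.

Hypothesis indep : mutually_independent tau.

Lemma pr_box s Y : uniq s -> (forall e, measurable (Y e)) ->
  P (env @^-1` (box s Y)) = (\prod_(e <- s) P (tau e @^-1` Y e))%E.
Proof. by move=> us mY; rewrite -indep. Qed.

Lemma box_undup s (Y : edge d -> set R) : box (undup s) Y = box s Y.
Proof. by apply/seteqP; split=> t H e es; apply: H; rewrite ?mem_undup// in es *. Qed.

Lemma pr_boxI S S' B B' : (forall e, S e -> S' e -> False) ->
  boxes S B -> boxes S' B' ->
  P (env @^-1` (B `&` B')) = (P (env @^-1` B) * P (env @^-1` B'))%E.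
Proof.
move=> SS' [s [Y [sS mY ->]]] [s' [Y' [sS' mY' ->]]].
rewrite -(box_undup s) -(box_undup s').
have ss' e : e \in s' -> e \in s -> False by move=> /sS' + /sS; move=> /[swap]; exact: SS'.
rewrite (_ : _ `&` _ = box (undup s ++ undup s')
    (fun e => if e \in s then Y e else Y' e)); last first.
  apply/seteqP; split=> [t [H H'] e|t H].
    rewrite mem_cat !mem_undup; case: ifPn => /= es; first by move=> _; apply: H; rewrite mem_undup.
    by move=> es'; apply: H'; rewrite mem_undup.
  split=> e; rewrite mem_undup => es; have := H e; rewrite mem_cat !mem_undup es.
    by move=> /(_ isT).
  by rewrite orbT => /(_ isT); case: ifPn => // /(ss' _ es).
rewrite !pr_box ?undup_uniq//; last 2 first.
- rewrite cat_uniq !undup_uniq /= andbT; apply/hasPn => e; rewrite /= !mem_undup => es'.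
  by apply/negP => /(ss' _ es').
- by move=> e; case: ifP.
rewrite big_cat /=; congr (_ * _)%E; apply: eq_big_seq => e; rewrite mem_undup.
  by move=> ->.
by move=> es; case: ifPn => // /(ss' _ es).
Qed.

Lemma P_env_setC B : sig setT B ->
  P (env @^-1` (~` B)) = (1 - P (env @^-1` B))%E.
Proof.
by move=> mB; rewrite -preimage_setC probability_setC//; exact: measurable_env.
Qed.

(** Dynkin induction in one event while [C] stays arbitrary. Used twice by [pr_indep], it passes
    from boxes to both sigma-algebras. *)
Lemma pr_indep_half S (C : set (edge d -> R)) : sig setT C ->
  (forall B, boxes S B -> P (env @^-1` (B `&` C)) = (P (env @^-1` B) * P (env @^-1` C))%E) ->
  forall B, sig S B -> P (env @^-1` (B `&` C)) = (P (env @^-1` B) * P (env @^-1` C))%E.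
Proof.
move=> mC BC B SB.
have ST (X : set (edge d -> R)) : sig S X -> sig setT X by apply: sig_mono.
have mP X : sig setT X -> measurable (env @^-1` X) by exact: measurable_env.
have fP X : sig setT X -> P (env @^-1` X) \is a fin_num.
  by move=> mX; rewrite fin_num_measure//; exact: mP.
pose Q (B : set (edge d -> R)) :=
  sig S B -> P (env @^-1` (B `&` C)) = (P (env @^-1` B) * P (env @^-1` C))%E.
apply: (@dynkin_induction _ (wtype R S) (boxes S) Q) => //.
- exact: boxes_setI.
- by rewrite /Q setTI preimage_setT probability_setT mul1e.
- by move=> X BX _; exact: BC.
- move=> X SX /(_ SX) QX _; have mX := ST _ SX.
  have : P (env @^-1` C) = (P (env @^-1` (~` X `&` C)) + P (env @^-1` (X `&` C)))%E.
    rewrite (measureDI P (mP _ mC) (mP _ mX)); congr (P _ + P _)%E.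
      by apply/seteqP; split=> w [].
    by apply/seteqP; split=> w [].
  rewrite QX.
  rewrite P_env_setC// -!EFin_pr//; last by apply: sigI => //; exact: sigC.
  rewrite -!EFinB -!EFinM -EFinD => -[eC]; congr (_%:E).
  rewrite mulrBl mul1r {1}eC; ring.
- move=> F mF tF QF _.
  rewrite setI_bigcupl !preimage_bigcup.
  have mFT n : sig setT (F n) by apply: ST; exact: mF.
  rewrite !measure_bigcup//=; last 4 first.
  + by move=> n _; exact: mP.
  + by move=> i j _ _ [w [/= Fi Fj]]; apply: tF => //; exists (env w).
  + by move=> n _; apply: mP; exact: sigI.
  + by move=> i j _ _ [w [/= [Fi _] [Fj _]]]; apply: tF => //; exists (env w).
  rewrite -(EFin_pr mC) muleC -nneseriesZl// EFin_pr//.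
  apply: eq_eseriesr => n _; exact: etrans (QF n (mF n)) (muleC _ _).
Qed.

Lemma pr_indep S S' B B' : (forall e, S e -> S' e -> False) ->
  sig S B -> sig S' B' -> pr (B `&` B') = pr B * pr B'.
Proof.
move=> SS' SB SB'.
have ST S0 (X : set (edge d -> R)) : sig S0 X -> sig setT X by apply: sig_mono.
have bs S0 (X : set (edge d -> R)) : boxes S0 X -> sig S0 X by move=> ?; exact: sub_sigma_algebra.
apply: EFin_inj; rewrite EFinM !EFin_pr; last 3 first.
- exact: (ST _ _ SB').
- exact: (ST _ _ SB).
- by apply: sigI; [exact: (ST _ _ SB)|exact: (ST _ _ SB')].
apply: (@pr_indep_half S) => //; first exact: (ST _ _ SB').
move=> X bX; rewrite setIC [RHS]muleC; apply: (@pr_indep_half S') => //.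
  apply: ST. exact: (bs _ _ bX).
by move=> Y bY; rewrite setIC [RHS]muleC; apply: (pr_boxI SS').
Qed.

Lemma pr_indep_seq (I : choiceType) (s : seq I) (S : I -> set (edge d))
    (B : I -> set (edge d -> R)) (p : R) : uniq s ->
  (forall i j e, i \in s -> j \in s -> S i e -> S j e -> i = j) ->
  (forall i, i \in s -> sig (S i) (B i)) ->
  (forall i, i \in s -> pr (B i) <= p) ->
  pr (\bigcap_(i in [set` s]) B i) <= p ^+ size s.
Proof.
move=> + dS mB pB; elim: s dS mB pB => [|i s IH] dS mB pB /=.
  by move=> _; rewrite expr0; apply: pr_le1; apply: sig_bigI.
move=> /andP[nis us].
have ii : i \in i :: s by rewrite mem_head.
have si j : j \in s -> j \in i :: s by rewrite inE => ->; rewrite orbT.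
rewrite (_ : \bigcap_(j in _) _ = B i `&` \bigcap_(j in [set` s]) B j); last first.
  apply/seteqP; split=> [t H|t [Bi H] j].
    by split=> [|j js]; apply: H => //=; exact: si.
  by rewrite /= inE => /orP[/eqP ->//|]; exact: H.
rewrite (@pr_indep (S i) [set e | exists2 j, j \in s & S j e]).
- rewrite exprS; apply: ler_pM; rewrite ?pr_ge0 ?pB//.
  apply: IH => // [j k e /si js /si ks|j /si js|j /si js].
  + exact: dS.
  + exact: mB.
  + exact: pB.
- move=> e Sie [j js Sje]; have ij := dS _ _ _ ii (si _ js) Sie Sje.
  by rewrite ij js in nis.
- exact: mB.
- apply: sig_bigI => j js; apply: sig_mono (mB _ (si _ js)) => e Se.
  by exists j.
Qed.

Hypothesis ident : identically_distributed tau.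

(** On a box, distinct edges stay distinct under [f], and [g] recovers the constraint that each
    carries; Dynkin induction extends this to all events. It serves for lattice shifts. *)
Lemma pr_reindex (f g : edge d -> edge d) (B : set (edge d -> R)) : cancel f g -> sig setT B ->
  pr [set t : edge d -> R | B (t \o f)] = pr B.
Proof.
move=> fK mB; rewrite /pr; congr fine; move: B mB.
pose Q (B : set (edge d -> R)) := measurable [set w | B (env w \o f)] /\
  P [set w | B (env w \o f)] = P (env @^-1` B).
suff H B : sig setT B -> Q B by move=> B /H [].
apply: (@dynkin_induction _ (wtype R setT) (boxes setT) Q) => //.
- exact: boxes_setI.
- by split; [exact: measurableT|congr (P _)].
- move=> _ [s [Y [_ mY ->]]]; rewrite -box_undup.
  rewrite /Q (_ : [set w | _] =
      env @^-1` box (map f (undup s)) (fun e => Y (g e))); last first.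
    apply/seteqP; split=> w H e.
      by move=> /mapP[e' e's ->]; rewrite fK; exact: H.
    by move=> es; have := H (f e); rewrite fK; apply; exact: map_f.
  split; first exact: measurable_box.
  rewrite !pr_box ?undup_uniq ?map_inj_uniq ?undup_uniq//; last exact: can_inj fK.
  by rewrite big_map; apply: eq_bigr => e _; rewrite fK; exact: ident.
- move=> X mX [mX' QX]; rewrite /Q.
  rewrite (_ : [set w | _] = ~` [set w | X (env w \o f)])//.
  split; first exact: measurableC.
  by rewrite P_env_setC// probability_setC// QX.
- move=> F mF tF QF; rewrite /Q.
  rewrite (_ : [set w | _] = \bigcup_k [set w | F k (env w \o f)])//.
  split; first by apply: bigcupT_measurable => k; case: (QF k).
  rewrite preimage_bigcup !measure_bigcup//=.
  + by apply: eq_eseriesr => n _; case: (QF n).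
  + by move=> n _; apply: measurable_env; exact: mF.
  + by move=> i j _ _ [w [/= Fi Fj]]; apply: tF => //; exists (env w).
  + by move=> n _; case: (QF n).
  + by move=> i j _ _ [w [/= Fi Fj]]; apply: tF => //; exists (env w \o f).
Qed.

End pr.

(** * Lattice paths *)

Section paths.
Context (d : nat).
Implicit Types (z a b c : 'rV[int]_d) (p q : seq (step d)).

Definition l1 z : nat := (\sum_i absz (z 0%R i))%N.

Lemma l1D z a : (l1 (z + a) <= l1 z + l1 a)%N.
Proof.
by rewrite /l1 -big_split; apply: leq_sum => i _; rewrite mxE -lez_nat PoszD !abszE ler_normD.
Qed.

Lemma l1N z : l1 (- z) = l1 z.
Proof. by apply: eq_bigr => i _; rewrite mxE abszN. Qed.

Lemma l1_eq0 z : l1 z = 0%N -> z = 0.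
Proof.
move=> /eqP; rewrite sum_nat_eq0 => /forallP z0; apply/rowP => i.
by have := z0 i; rewrite mxE /= absz_eq0 => /eqP.
Qed.

Lemma l1_move z (s : step d) : l1 (move z s - z) = 1%N.
Proof.
have l1d i : l1 (delta_mx 0 i) = 1%N.
  rewrite /l1 (bigD1 i)//= mxE !eqxx/= big1// => j ji; rewrite mxE (negbTE ji).
  by rewrite andbF.
by rewrite /move; case: ifP => _; rewrite addrC addKr ?l1N l1d.
Qed.

Lemma l1_step z : l1 z != 0%N -> exists s, (l1 (z - move 0 s)).+1 = l1 z.
Proof.
rewrite sum_nat_eq0 => /forallPn[i]; rewrite /= -lt0n => zi.
exists (i, 0 <= z 0 i); rewrite /l1 (bigD1 i)//= [in RHS](bigD1 i)//= -addSn.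
congr (_ + _)%N; last first.
  apply: eq_bigr => j ji; rewrite /move /=.
  by case: ifP => _; rewrite !mxE /= (negbTE ji) ?subr0 ?add0r ?oppr0 ?subr0.
by rewrite /move; case: ifPn => /= z0; rewrite !mxE !eqxx /=; lia.
Qed.

Lemma path_end_cat z p q : path_end z (p ++ q) = path_end (path_end z p) q.
Proof. exact: foldl_cat. Qed.

Lemma mem_vertices_cons z s p a :
  (a \in path_vertices z (s :: p)) = (a == z) || (a \in path_vertices (move z s) p).
Proof. by []. Qed.

Lemma mem_start z p : z \in path_vertices z p.
Proof. exact: mem_head. Qed.

Lemma mem_end z p : path_end z p \in path_vertices z p.
Proof.
elim: p z => [|s p IH] z; first exact: mem_head.
by rewrite mem_vertices_cons IH orbT.
Qed.

Lemma mem_vertices_cat z p q a :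
  (a \in path_vertices z (p ++ q)) =
  (a \in path_vertices z p) || (a \in path_vertices (path_end z p) q).
Proof.
elim: p z => [|s p IH] z; first by rewrite /= !inE; case: eqP => // ->; rewrite mem_start.
by rewrite cat_cons !mem_vertices_cons IH orbA.
Qed.

Lemma path_edges_cat z p q :
  path_edges z (p ++ q) = path_edges z p ++ path_edges (path_end z p) q.
Proof. by elim: p z => //= s p IH z; rewrite IH. Qed.

(** Both endpoints are required, so regions without a common vertex have disjoint edge sets, hence
    independent events. *)
Definition inside (A : set 'rV[int]_d) : set (edge d) :=
  [set e | A e.1 /\ A (e.1 + delta_mx 0 e.2)].

Lemma path_edges_inside (A : set 'rV[int]_d) z p :
  (forall a, a \in path_vertices z p -> A a) ->
  forall e, e \in path_edges z p -> inside A e.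
Proof.
elim: p z => [//|s p IH] z Ap e; rewrite inE => /orP[/eqP ->|]; last first.
  by apply: IH => a ap; apply: Ap; rewrite mem_vertices_cons ap orbT.
have A1 : A z by apply: Ap; exact: mem_start.
have A2 : A (move z s).
  by apply: Ap; rewrite mem_vertices_cons mem_start orbT.
rewrite /inside /step_edge /=; move: A2; rewrite /move.
by case: ifP => //= _ A2; rewrite subrK.
Qed.

Definition shift_edge a (e : edge d) : edge d := (e.1 + a, e.2).

Lemma shift_edgeK a : cancel (shift_edge a) (shift_edge (- a)).
Proof. by case=> z i; rewrite /shift_edge /= addrK. Qed.

Lemma move_shift a z s : move (z + a) s = move z s + a.
Proof. by rewrite /move; case: ifP; rewrite addrAC. Qed.

Lemma path_end_shift a z p : path_end (z + a) p = path_end z p + a.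
Proof. by elim: p z => //= s p IH z; rewrite move_shift IH. Qed.

Lemma path_vertices_shift a z p :
  path_vertices (z + a) p = [seq x + a | x <- path_vertices z p].
Proof.
elim: p z => //= s p IH z.
by rewrite /path_vertices /= move_shift -IH.
Qed.

Lemma path_edges_shift a z p :
  path_edges (z + a) p = [seq shift_edge a e | e <- path_edges z p].
Proof.
elim: p z => //= s p IH z; rewrite move_shift IH; congr (_ :: _).
by rewrite /step_edge /shift_edge /=; case: ifP => //; rewrite move_shift.
Qed.

Lemma line_path a b : exists p, [/\ path_end a p = b, size p = l1 (b - a)
  & forall z, z \in path_vertices a p -> (l1 (z - a) <= l1 (b - a))%N].
Proof.
have [n le] : exists n, l1 (b - a) = n by eexists.
elim: n a le => [|n IH] a le.
  exists [::]; split=> //; first by move/l1_eq0: le => /eqP; rewrite subr_eq0 => /eqP.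
  by move=> z; rewrite inE => /eqP ->; rewrite subrr /l1 big1// => i _; rewrite mxE.
have [|s] := @l1_step (b - a); first by rewrite le.
rewrite le => -[ls]; have ms : b - a - move 0 s = b - move a s.
  by rewrite -[a in RHS]add0r move_shift opprD addrA addrAC.
rewrite ms in ls; have [p [pe ps pv]] := IH _ ls.
exists (s :: p); split=> //=; first by rewrite ps ls.
move=> z; rewrite mem_vertices_cons => /orP[/eqP ->|/pv].
  by rewrite subrr /l1 big1// => i _; rewrite mxE.
rewrite ls => zn; apply: leq_trans (_ : l1 (z - move a s) + l1 (move a s - a) <= _)%N.
  by apply: leq_trans (l1D _ _); rewrite addrA subrK.
by rewrite l1_move addn1.
Qed.

Section times.
Context (R : realType).
Implicit Types (t : edge d -> R) (A : set 'rV[int]_d) (s : R).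

Lemma path_time_cat t z p q :
  path_time t z (p ++ q) = path_time t z p + path_time t (path_end z p) q.
Proof. by rewrite /path_time path_edges_cat big_cat. Qed.

Lemma size_path_edges z p : size (path_edges z p) = size p.
Proof. by elim: p z => //= s p IH z; rewrite IH. Qed.

Definition bounded_weights (C : R) : set (edge d -> R) :=
  [set t | forall e, 0 <= t e <= C].

Lemma path_time_ge0 C t z p : bounded_weights C t -> 0 <= path_time t z p.
Proof. by move=> tC; apply: sumr_ge0 => e _; case/andP: (tC e). Qed.

Lemma path_time_le C t z p : bounded_weights C t ->
  path_time t z p <= C * (size p)%:R.
Proof.
move=> tC; rewrite -(size_path_edges z) /path_time.
elim: (path_edges z p) => [|e r IH]; first by rewrite big_nil mulr0.
by rewrite big_cons /= mulrSr mulrDr mulr1 addrC lerD//; case/andP: (tC e).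
Qed.

(** An existence statement instead of a bound on the infimum: it concatenates well, and as an
    instance of [fast] it is measurable in the edges inside [A]. *)
Definition connects t A a b s :=
  fast [set zp | [/\ zp.1 = a, path_end a zp.2 = b
    & forall z, z \in path_vertices a zp.2 -> A z]] s t.

Lemma connectsP t A a b s : connects t A a b s <->
  exists p, [/\ path_end a p = b,
    forall z, z \in path_vertices a p -> A z & path_time t a p <= s].
Proof.
split; first by case=> -[_ p] [/= -> pe pA] ps; exists p.
by case=> p [pe pA ps]; exists (a, p).
Qed.

Lemma sig_connects A a b s : sig (inside A) [set t | connects t A a b s].
Proof. by apply: sig_fast => -[z p] e [/= -> _ pA]; exact: path_edges_inside. Qed.

Lemma connects_sub t A A' a b s s' : A `<=` A' -> s <= s' ->
  connects t A a b s -> connects t A' a b s'.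
Proof.
move=> AA' ss' /connectsP[p [pe pA ps]]; apply/connectsP; exists p; split=> //.
  by move=> z /pA /AA'.
exact: le_trans ss'.
Qed.

Lemma connects_cat t A a b c s s' :
  connects t A a b s -> connects t A b c s' -> connects t A a c (s + s').
Proof.
move=> /connectsP[p [pe pA ps]] /connectsP[q [qe qA qs]]; apply/connectsP.
exists (p ++ q); split.
- by rewrite path_end_cat pe.
- by move=> z; rewrite mem_vertices_cat pe => /orP[/pA|/qA].
- by rewrite path_time_cat pe lerD.
Qed.

Lemma connects_refl t A a : A a -> connects t A a a 0.
Proof.
move=> Aa; apply/connectsP; exists [::]; split=> //; last by rewrite /path_time big_nil.
by move=> z; rewrite inE => /eqP ->.
Qed.

Lemma connects_chain t A (z : nat -> 'rV[int]_d) (s : nat -> R) n : A (z 0%N) ->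
  (forall i, (i < n)%N -> connects t A (z i) (z i.+1) (s i)) ->
  connects t A (z 0%N) (z n) (\sum_(i < n) s i).
Proof.
move=> A0; elim: n => [_|n IH H]; first by rewrite big_ord0; exact: connects_refl.
rewrite big_ord_recr /=; apply: connects_cat; last exact: H.
by apply: IH => i ni; apply: H; rewrite ltnS ltnW.
Qed.

Lemma connects_shift t A x a b s :
  connects t [set z | A (z - x)] (a + x) (b + x) s <->
  connects (t \o shift_edge x) A a b s.
Proof.
rewrite !connectsP; split=> -[p [pe pA ps]]; exists p.
  rewrite path_end_shift in pe; split; first exact: addIr pe.
    move=> z zp; have := pA (z + x); rewrite /= addrK; apply.
    by rewrite path_vertices_shift; apply/mapP; exists z.
  by move: ps; rewrite /path_time path_edges_shift big_map.
split; first by rewrite path_end_shift pe.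
  by move=> z; rewrite path_vertices_shift => /mapP[y /pA Ay ->] /=; rewrite addrK.
by rewrite /path_time path_edges_shift big_map.
Qed.

Lemma connects_line C t A a b : 0 <= C -> bounded_weights C t ->
  (forall z, (l1 (z - a) <= l1 (b - a))%N -> A z) ->
  connects t A a b (C * (l1 (b - a))%:R).
Proof.
move=> C0 tC HA; have [p [pe ps pv]] := line_path a b.
apply/connectsP; exists p; split=> //; first by move=> z /pv; exact: HA.
by rewrite -ps; exact: path_time_le.
Qed.

End times.
End paths.

(** * Passage times as connection events *)

Import HBNNSimple.

(* Measurability of [f] plays no role because the integral of a nonnegative
   function is a supremum over the simple functions below it. *)
Lemma markov_ge0 (R : realType) disp (Omega : measurableType disp)
    (P : probability Omega R) (f : Omega -> \bar R) (E : set Omega) (c : R) :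
  (forall w, 0 <= f w)%E -> measurable E -> 0 <= c ->
  (forall w, E w -> c%:E <= f w)%E -> (c%:E * P E <= \int[P]_w f w)%E.
Proof.
move=> f0 mE c0 cf; rewrite ge0_integralTE// -(sintegral_indic P E).
rewrite (_ : \1_E = indic_nnsfun R mE)// -sintegralrM.
apply: ereal_sup_ubound; exists (scale_nnsfun (indic_nnsfun R mE) c0) => // w /=.
have [wE|nE] := boolP (w \in E).
  by rewrite mindicE wE mulr1; apply: cf; rewrite inE in wE.
by rewrite mindicE (negbTE nE) mulr0.
Qed.

Section connection_probabilities.
Context (R : realType) (d : nat) (disp : measure_display).
Context (Omega : measurableType disp) (P : probability Omega R).
Variable tau : edge d -> {RV P >-> R}.

Definition lat (A : set 'rV[R]_d) : set 'rV[int]_d := [set z | A (to_real R z)].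

Lemma connects_passage_le t A x y s :
  connects t (lat A) (floor_pt x) (floor_pt y) s ->
  (passage_time t A x y <= s%:E)%E.
Proof.
move=> /connectsP[p [pe pA ps]]; apply: ge_ereal_inf; exists (path_time t (floor_pt x) p)%:E.
  by exists p.
by rewrite lee_fin.
Qed.

Lemma passage_ge t A x y s :
  ~ connects t (lat A) (floor_pt x) (floor_pt y) s ->
  (s%:E <= passage_time t A x y)%E.
Proof.
move=> nc; apply: le_ereal_inf_tmp => _ [p [pe pA] <-].
rewrite lee_fin leNgt; apply/negP => /ltW ps; apply: nc.
by apply/connectsP; exists p.
Qed.

Lemma sigT_connects A a b (s : R) : sig setT [set t : edge d -> R | connects t A a b s].
Proof. by apply: sig_mono (@sig_connects _ _ A a b s). Qed.

Lemma sig_countable_union S (F : nat -> set (edge d -> R)) :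
  (forall n, sig S (F n)) -> sig S (\bigcup_n F n).
Proof. exact: (@bigcupT_measurable _ (wtype R S)). Qed.

(** The infimum over infinitely many paths need not be attained, so [s < T_in] is stronger than
    having no path of time at most [s]: connection must fail for some threshold above [s]. *)
Lemma lt_passageE A x y s :
  [set w | (s%:E < T_in tau A x y w)%E] = env tau @^-1`
    \bigcup_n ~` [set t | connects t (lat A) (floor_pt x) (floor_pt y) (s + n.+1%:R^-1)].
Proof.
apply/seteqP; split=> w /=; last first.
  move=> [n _ /= /passage_ge]; apply: lt_le_trans.
  by rewrite lte_fin ltrDl invr_gt0.
rewrite /T_in => sT; apply: contrapT => H.
have cn n : connects (env tau w) (lat A) (floor_pt x) (floor_pt y) (s + n.+1%:R^-1).
  by apply: contrapT => nc; apply: H; exists n.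
move: sT; apply/negP; rewrite -leNgt; apply/lee_addgt0Pr => e e0.
have [n ne] : exists n, n.+1%:R^-1 <= e.
  exists (Num.bound e^-1); rewrite invf_ple ?posrE//.
  have e1 : 0 <= e^-1 by rewrite invr_ge0 ltW.
  by apply: le_trans (ltW (archi_boundP e1)) _; rewrite ler_nat.
apply: le_trans (connects_passage_le (cn n)) _.
by rewrite -EFinD lee_fin lerD2l.
Qed.

Lemma P_lt_passage A x y s :
  (P [set w | (s%:E < T_in tau A x y w)%E] <=
   (pr tau (~` [set t | connects t (lat A) (floor_pt x) (floor_pt y) s]))%:E)%E.
Proof.
rewrite lt_passageE.
have mC s' := sigC (sigT_connects (lat A) (floor_pt x) (floor_pt y) s').
rewrite EFin_pr; last exact: mC.
apply: le_measure; rewrite ?inE.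
- by apply: measurable_env; apply: sig_countable_union => n; exact: mC.
- exact: measurable_env (mC _).
- move=> w [n _ /= nc] c; apply: nc; apply: connects_sub c => //.
  by rewrite lerDl invr_ge0.
Qed.

(** Markov's inequality for the positive part: without a path of time at most [mu x + s] the excess
    is at least [s]. *)
Lemma pr_excess mu A x s : 0 < s ->
  ((s * pr tau (~` [set t | connects t (lat A) 0 (floor_pt x) (mu x + s)]))%:E
   <= expected_excess tau mu A x)%E.
Proof.
move=> s0; set E := ~` _.
have mE : sig setT E by apply: sigC; exact: sigT_connects.
rewrite EFinM EFin_pr//; apply: markov_ge0.
- by move=> w; rewrite le_max lexx orbT.
- exact: measurable_env.
- exact: ltW.
- move=> w Ew; rewrite le_max; apply/orP; left.
  rewrite leeBrDr// -EFinD addrC; apply: passage_ge.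
  rewrite (_ : floor_pt 0 = 0)//.
  by apply/rowP => i; rewrite !mxE floor0.
Qed.

Hypothesis indep : mutually_independent tau.
Hypothesis ident : identically_distributed tau.

Lemma pr_connects_shift A x a b s :
  pr tau [set t | connects t [set z | A (z - x)] (a + x) (b + x) s] =
  pr tau [set t | connects t A a b s].
Proof.
rewrite -(pr_reindex indep ident (shift_edgeK x) (sigT_connects A a b s)).
by congr (pr tau _); apply/seteqP; split=> t /connects_shift.
Qed.

Variable C : R.
Hypothesis tau_ge0 : forall e w, 0 <= tau e w.
Hypothesis tau_le : forall e, P [set w | tau e w <= C] = 1%E.

Lemma sig_bounded_weights : sig setT (bounded_weights C : set (edge d -> R)).
Proof.
rewrite (_ : bounded_weights C = ~` \bigcup_(e : edge d) ~` (box [:: e] (fun=> `[0, C]%classic))).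
  apply: sigC; apply: (@countable_bigcupT_measurable _ (wtype R setT)).
    exact: countableP.
  move=> e; apply: sigC; apply: sub_sigma_algebra; exists [:: e], (fun=> `[0, C]%classic).
  by split.
apply/seteqP; split=> t H.
  by move=> [e _ /=]; apply=> e' _ /=; rewrite in_itv; exact: H.
move=> e; apply: contrapT => nC; apply: H; exists e => // /(_ e).
by rewrite /= in_itv mem_head => /(_ isT).
Qed.

Lemma negligible_unbounded : P (env tau @^-1` (~` bounded_weights C)) = 0%E.
Proof.
have mB := sigC sig_bounded_weights.
apply: measure_negligible; first exact: measurable_env.
pose F (n : nat) := if unpickle n is Some e then ~` [set w | tau e w <= C] else set0.
apply: negligibleS (_ : _ `<=` \bigcup_n F n) _.
  move=> w nb; apply: contrapT => H; apply: nb => e; rewrite tau_ge0 /=.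
  by apply: contrapT => nC; apply: H; exists (pickle e) => //; rewrite /F pickleK.
apply: negligible_bigcup => n; rewrite /F; case: unpickle => [e|]; last first.
  exact: negligible_set0.
have m1 : measurable [set w | tau e w <= C].
  rewrite (_ : mkset _ = tau e @^-1` `]-oo, C]%classic).
    by rewrite -[X in measurable X]setTI; exact: measurable_funPT.
  by apply/seteqP; split=> w /=; rewrite in_itv.
apply/negligibleP; first exact: measurableC.
by have := probability_setC P m1; rewrite tau_le subee.
Qed.

(** Deterministic bounds such as time at most [C] per edge hold only for weights in [[0, C]]; these
    have full probability because there are countably many edges. *)
Lemma pr_le B B' : sig setT B -> sig setT B' ->
  (forall t, bounded_weights C t -> B t -> B' t) -> pr tau B <= pr tau B'.
Proof.
move=> mB mB' BB'; have mN := sigC sig_bounded_weights.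
apply: (@le_trans _ _ (pr tau (B' `|` ~` bounded_weights C))).
  apply: pr_mono => //; first exact: sigU.
  by move=> t Bt; have [/BB'/(_ Bt)|] := pselect (bounded_weights C t); [left|right].
apply: le_trans (pr_setU _ mB' mN) _.
by rewrite gerDl /pr negligible_unbounded.
Qed.

End connection_probabilities.

(** * Comparison of the norm [mu] with the sup norm *)

Section norms.
Context (R : realType) (d : nat).
Variables (mu : 'rV[R]_d -> R) (mu_norm : is_norm mu).

Lemma muD x y : mu (x + y) <= mu x + mu y. Proof. by case: mu_norm. Qed.
Lemma muZ a x : mu (a *: x) = `|a| * mu x. Proof. by case: mu_norm. Qed.

Lemma mu_ge0 x : 0 <= mu x.
Proof.
have := muD x (- x); rewrite subrr -scaleN1r muZ normrN1 mul1r.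
have -> : mu 0 = 0 by rewrite -(scale0r 0) muZ normr0 mul0r.
lra.
Qed.

Lemma coord_le_norm (x : 'rV[R]_d) i : `|x 0 i| <= `|x|.
Proof.
rewrite [leRHS]mx_normrE.
exact: (le_bigmax _ (fun ij : 'I_1 * 'I_d => `|x ij.1 ij.2|) (0, i)).
Qed.

Lemma mu_le : exists2 B, 0 < B & forall x, mu x <= B * `|x|.
Proof.
exists (1 + \sum_i mu (delta_mx 0 i)).
  by rewrite ltr_pwDl// sumr_ge0// => i _; exact: mu_ge0.
move=> x; apply: (@le_trans _ _ (\sum_i `|x 0 i| * mu (delta_mx 0 i))).
  rewrite {1}(row_sum_delta x); elim/big_ind2: _ => [|a b a' b' aa' bb'|i _].
  - by rewrite -(scale0r 0) muZ normr0 mul0r.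
  - exact: le_trans (muD _ _) (lerD aa' bb').
  - by rewrite muZ.
rewrite mulrDl mul1r mulr_suml -[leLHS]add0r lerD//.
by apply: ler_sum => i _; rewrite mulrC ler_wpM2l ?mu_ge0 ?coord_le_norm.
Qed.

Lemma mu_continuous : continuous mu.
Proof.
have [B B0 muB] := mu_le.
have lip x y : `|mu x - mu y| <= B * `|x - y|.
  have H a b : mu a - mu b <= B * `|a - b|.
    by rewrite lerBlDr (le_trans _ (lerD (muB _) (lexx _)))// -{1}(subrK b a) muD.
  by rewrite ler_norml H andbT lerNl opprB -normrN opprB H.
move=> x; apply/(@cvgrPdist_lt _ _ _ _ (nbhs_filter x)) => e e0; apply/nbhs_ballP.
exists (e / B); first by rewrite /= divr_gt0.
move=> y; rewrite mx_norm_ball => xy; apply: le_lt_trans (lip _ _) _.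
by rewrite mulrC -ltr_pdivlMr.
Qed.

(** [mu] attains a minimum on the compact unit sphere of the sup norm, positive by definiteness. *)
Lemma mu_ge : exists2 k, 0 < k & forall x, k * `|x| <= mu x.
Proof.
pose A := [set x : 'rV[R]_d | `|x| = 1].
have mu0 : mu 0 = 0 by rewrite -(scale0r 0) muZ normr0 mul0r.
have inA x : x != 0 -> A (`|x|^-1 *: x).
  by move=> x0; rewrite /A /= normrZ normfV normr_id mulVf// normr_eq0.
(* The sphere is empty only in dimension 0, where any constant works. *)
have [A0|nA] := pselect (A !=set0); last first.
  exists 1 => // x; have [->|/inA xA] := eqVneq x 0; first by rewrite normr0 mulr0 mu0.
  by exfalso; apply: nA; exists (`|x|^-1 *: x).
have cA : compact A.
  apply: bounded_closed_compact.
    by exists 1; split => // y y1 x /= ->; exact: ltW.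
  by apply: (@closed_comp _ _ (fun x : 'rV[R]_d => `|x|) [set 1]);
    [move=> x _; exact: norm_continuous|exact: closed_eq].
have [c cA' cmin] := EVT_min_rV A0 cA (continuous_subspaceT mu_continuous).
rewrite inE in cA'; have c0 : 0 < mu c.
  rewrite lt_def mu_ge0 andbT; apply/eqP => /(let: And3 _ _ H := mu_norm in H c) c0.
  by move: cA'; rewrite /A /= c0 normr0 => /esym/eqP; rewrite oner_eq0.
exists (mu c) => // x; have [->|x0] := eqVneq x 0; first by rewrite normr0 mulr0 mu0.
have := cmin (`|x|^-1 *: x); rewrite inE => /(_ (inA _ x0)).
by rewrite muZ normfV normr_id ler_pdivlMl ?normr_gt0// mulrC.
Qed.

End norms.

(** * Law of large numbers along one lattice vector *)

Section lln.
Context (R : realType) (d : nat) (disp : measure_display).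
Context (Omega : measurableType disp) (P : probability Omega R).
Variable tau : edge d -> {RV P >-> R}.
Variables (mu : 'rV[R]_d -> R) (mu_tc : time_constant tau mu).

Lemma floor_to_real (z : 'rV[int]_d) : floor_pt (to_real R z) = z.
Proof. by apply/rowP => i; rewrite !mxE intrKfloor. Qed.

(** On this event the rescaled time differs from its limit by at least half of it, so the L^1
    convergence and Markov's inequality make the event rare. *)
Lemma pr_fast_lln (z : 'rV[int]_d) (r : R) : 0 < mu (to_real R z) -> 0 < r ->
  exists N0, forall N, (N0 <= N)%N ->
  pr tau [set t | connects t setT 0 (z *+ N) (N%:R * mu (to_real R z) / 2)] <= r.
Proof.
set x := to_real R z; move=> mux r0; have [_ /(_ z)[_ /= L1]] := mu_tc.
have e0 : (0%:E < (mu x / 2 * r)%:E)%E by rewrite lte_fin mulr_gt0// divr_gt0.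
have /L1 [N0 _ HN] : nbhs 0%E [set y | (y < (mu x / 2 * r)%:E)%E] by exact: open_ereal_lt'.
exists N0.+1 => -[//|N] NN; have := HN N.+1 (ltnW NN); rewrite /=.
set E := [set t | _]; have mE : sig setT E by exact: sigT_connects.
move=> /ltW HE.
rewrite -(ler_pM2l (divr_gt0 mux (ltr0n R 2))) -lee_fin; apply: le_trans HE.
rewrite EFinM EFin_pr//; apply: markov_ge0.
- by move=> w; exact: abse_ge0.
- exact: measurable_env.
- by rewrite divr_ge0// ltW.
move=> w /= cE; rewrite /rescaled_time.
have TN : (T_in tau setT 0 (N.+1%:R *: x) w <= (N.+1%:R * mu x / 2)%:E)%E.
  apply: connects_passage_le; rewrite (_ : floor_pt 0 = 0); last first.
    by apply/rowP => i; rewrite !mxE floor0.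
  rewrite (_ : floor_pt _ = z *+ N.+1); last first.
    rewrite (_ : _ *: x = to_real R (z *+ N.+1)) ?floor_to_real//.
    apply/rowP => i; rewrite !mxE; rewrite (_ : (z *+ N.+1) 0 i = z 0 i *+ N.+1).
      by rewrite mulr_natl rmorphMn.
    by elim: (N.+1) => [|n IH]; rewrite ?mulr0n ?mulrS ?mxE// IH.
  by apply: connects_sub cE => // ?.
have TN' : (T_in tau setT 0 (N.+1%:R *: x) w * (N.+1%:R^-1)%:E <= (mu x / 2)%:E)%E.
  rewrite (_ : mu x / 2 = N.+1%:R * mu x / 2 * N.+1%:R^-1); last first.
    by have := pnatr_eq0 R N.+1; move=> /negbT ?; field.
  by rewrite EFinM; apply: lee_wpmul2r => //; rewrite lee_fin invr_ge0.
move: TN'; case: (_ * _)%E => [y| |] //=; rewrite ?leey// !lee_fin => ym.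
by rewrite ler_normr; apply/orP; right; rewrite opprB lerBrDr; lra.
Qed.

End lln.

(** * Oblique coordinates in tilted cylinders *)

Section euclid.
Context (R : realType) (d : nat).
Implicit Types x y z : 'rV[R]_d.

Lemma dotDr x y z : dot x (y + z) = dot x y + dot x z.
Proof. by rewrite /dot -big_split; apply: eq_bigr => i _; rewrite mxE mulrDr. Qed.

Lemma dotC x y : dot x y = dot y x.
Proof. by apply: eq_bigr => i _; rewrite mulrC. Qed.

Lemma dotZr a x y : dot x (a *: y) = a * dot x y.
Proof. by rewrite /dot mulr_sumr; apply: eq_bigr => i _; rewrite mxE mulrCA. Qed.

Lemma dotNr x y : dot x (- y) = - dot x y.
Proof. by rewrite -scaleN1r dotZr mulN1r. Qed.

Lemma dotBr x y z : dot x (y - z) = dot x y - dot x z.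
Proof. by rewrite dotDr dotNr. Qed.

Lemma dot0r x : dot x 0 = 0.
Proof. by rewrite -(scale0r 0) dotZr mul0r. Qed.

Lemma dot_sumr x (I : Type) (r : seq I) (Q : pred I) (F : I -> 'rV[R]_d) :
  dot x (\sum_(i <- r | Q i) F i) = \sum_(i <- r | Q i) dot x (F i).
Proof. by apply: (big_morph (dot x)); [exact: dotDr|exact: dot0r]. Qed.

Lemma dot_ge0 x : 0 <= dot x x.
Proof. by apply: sumr_ge0 => i _; rewrite -expr2 sqr_ge0. Qed.

Lemma enorm_ge0 x : 0 <= enorm x. Proof. exact: sqrtr_ge0. Qed.

Lemma sqr_enorm x : enorm x ^+ 2 = dot x x.
Proof. by rewrite sqr_sqrtr// dot_ge0. Qed.

Lemma enormZ a x : enorm (a *: x) = `|a| * enorm x.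
Proof.
by rewrite /enorm dotZr dotC dotZr mulrA -expr2 sqrtrM ?sqr_ge0// sqrtr_sqr.
Qed.

Lemma coord_le_enorm x i : `|x 0 i| <= enorm x.
Proof.
rewrite -sqrtr_sqr; apply: ler_wsqrtr; rewrite /dot (bigD1 i)//= -expr2 lerDl.
by apply: sumr_ge0 => j _; rewrite -expr2 sqr_ge0.
Qed.

Lemma enorm_eq0 x : enorm x = 0 -> x = 0.
Proof.
move=> x0; apply/rowP => i; have := coord_le_enorm x i.
by rewrite x0 normr_le0 mxE => /eqP.
Qed.

Lemma dot_le_enorm x y : dot x y <= enorm x * enorm y.
Proof.
have [/enorm_eq0 ->|x0] := eqVneq (enorm x) 0.
  by rewrite dotC dot0r mulr_ge0 ?enorm_ge0.
have [/enorm_eq0 ->|y0] := eqVneq (enorm y) 0.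
  by rewrite dot0r mulr_ge0 ?enorm_ge0.
have xp : 0 < enorm x by rewrite lt_def x0 enorm_ge0.
have yp : 0 < enorm y by rewrite lt_def y0 enorm_ge0.
have := dot_ge0 (enorm y *: x - enorm x *: y).
rewrite dotBr !dotZr ![dot (_ - _) _]dotC !dotBr !dotZr (dotC y x) -!sqr_enorm => H.
have {}H : 0 <= (enorm x * enorm y) * (enorm x * enorm y - dot x y) by lra.
by move: H; rewrite pmulr_rge0 ?mulr_gt0// subr_ge0.
Qed.

Lemma enormD x y : enorm (x + y) <= enorm x + enorm y.
Proof.
rewrite -(@ler_pXn2r _ 2) ?nnegrE ?addr_ge0 ?enorm_ge0// sqrrD !sqr_enorm.
rewrite dotDr ![dot (_ + _) _]dotC !dotDr (dotC y x).
by have := dot_le_enorm x y; lra.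
Qed.

Lemma enormN x : enorm (- x) = enorm x.
Proof. by rewrite -scaleN1r enormZ normrN1 mul1r. Qed.

Definition n1 x : R := \sum_i `|x 0 i|.

Lemma n1_ge0 x : 0 <= n1 x. Proof. by apply: sumr_ge0. Qed.

Lemma n1D x y : n1 (x + y) <= n1 x + n1 y.
Proof. by rewrite /n1 -big_split; apply: ler_sum => i _; rewrite mxE ler_normD. Qed.

Lemma n1Z a x : n1 (a *: x) = `|a| * n1 x.
Proof. by rewrite /n1 mulr_sumr; apply: eq_bigr => i _; rewrite mxE normrM. Qed.

Lemma n1N x : n1 (- x) = n1 x.
Proof. by rewrite -scaleN1r n1Z normrN1 mul1r. Qed.

Lemma n1_le_norm x : n1 x <= d%:R * `|x|.
Proof.
apply: (@le_trans _ _ (\sum_(i < d) `|x|)).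
  by apply: ler_sum => i _; exact: coord_le_norm.
by rewrite sumr_const card_ord mulr_natl.
Qed.

Lemma n1_le_enorm x : n1 x <= d%:R * enorm x.
Proof.
apply: (@le_trans _ _ (\sum_(i < d) enorm x)).
  by apply: ler_sum => i _; exact: coord_le_enorm.
by rewrite sumr_const card_ord mulr_natl.
Qed.

Lemma norm_le_n1 x : `|x| <= n1 x.
Proof.
rewrite [leLHS]mx_normrE; apply/bigmax_leP; split; first exact: n1_ge0.
by move=> [i j] _ /=; rewrite (ord1 i) /n1 (bigD1 j)//= lerDl sumr_ge0.
Qed.

Lemma to_realD (a b : 'rV[int]_d) : to_real R (a + b) = to_real R a + to_real R b.
Proof. by apply/rowP => i; rewrite !mxE rmorphD. Qed.

Lemma to_realN (a : 'rV[int]_d) : to_real R (- a) = - to_real R a.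
Proof. by apply/rowP => i; rewrite !mxE rmorphN. Qed.

Lemma to_realMn (a : 'rV[int]_d) n : to_real R (a *+ n) = n%:R *: to_real R a.
Proof.
elim: n => [|n IH]; last by rewrite mulrS to_realD IH mulrS scalerDl scale1r.
by rewrite mulr0n scale0r; apply/rowP => i; rewrite !mxE.
Qed.

Lemma n1_to_real (a : 'rV[int]_d) : n1 (to_real R a) = (l1 a)%:R.
Proof.
rewrite /n1 /l1 natr_sum; apply: eq_bigr => i _; rewrite !mxE.
by rewrite natr_absz intr_norm.
Qed.

Definition frac_pt x := x - to_real R (floor_pt x).

Lemma n1_frac x : n1 (frac_pt x) <= d%:R.
Proof.
rewrite -[d in leRHS]card_ord -sum1_card natr_sum; apply: ler_sum => i _.
rewrite !mxE ger0_norm; first by rewrite lerBlDr addrC -intrD1; exact/ltW/floorD1_gt.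
by rewrite subr_ge0 floor_le.
Qed.

End euclid.

Section frame.
Context (R : realType) (d : nat) (ut : 'I_d -> 'rV[R]_d).
Hypothesis onb : orthonormal_basis ut.
Implicit Types x y z v w : 'rV[R]_d.

(** A one-sided inverse of a square matrix is two-sided, so orthonormality of the [d] rows already
    makes them a basis. *)
Lemma onb_expand x : x = \sum_i dot (ut i) x *: ut i.
Proof.
pose U : 'M[R]_d := \matrix_(i, j) ut i 0 j.
have UU : U *m U^T = 1%:M.
  apply/matrixP => i j; rewrite !mxE -onb /dot.
  by apply: eq_bigr => k _; rewrite !mxE.
have := mulmx1C UU => UU'.
have : x *m (U^T *m U) = x by rewrite UU' mulmx1.
rewrite mulmxA => {1}<-; apply/rowP => j; rewrite !mxE summxE.
apply: eq_bigr => i _; rewrite !mxE; congr (_ * _).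
by apply: eq_bigr => k _; rewrite !mxE mulrC.
Qed.

Lemma dot_ut_le i w : `|dot (ut i) w| <= n1 w.
Proof.
rewrite /dot /n1; apply: le_trans (ler_norm_sum _ _ _) _; apply: ler_sum => j _.
rewrite normrM ler_piMl//; apply: le_trans (coord_le_enorm _ _) _.
by rewrite /enorm onb eqxx sqrtr1.
Qed.

Variable o : 'I_d.
Hypothesis o0 : o = 0%N :> nat.
Variable l0 : R.
Hypothesis l0_gt0 : 0 < l0.

(* When [dot (ut o) v = l0], the coordinates of [z] in the basis formed by [v]
   and the [ut i], [i != o], are [ax z] and the [tr v i z]. *)
Definition ax z : R := dot (ut o) z / l0.
Definition tr v i z : R := dot (ut i) (z - ax z *: v).

Lemma axD x y : ax (x + y) = ax x + ax y.
Proof. by rewrite /ax dotDr mulrDl. Qed.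
Lemma axZ a x : ax (a *: x) = a * ax x.
Proof. by rewrite /ax dotZr mulrA. Qed.
Lemma axN x : ax (- x) = - ax x.
Proof. by rewrite -scaleN1r axZ mulN1r. Qed.

Lemma trD v i x y : tr v i (x + y) = tr v i x + tr v i y.
Proof. by rewrite /tr -dotDr axD; congr dot; rewrite scalerDl opprD addrACA. Qed.
Lemma trZ v i a x : tr v i (a *: x) = a * tr v i x.
Proof. by rewrite /tr -dotZr axZ; congr dot; rewrite scalerBr scalerA. Qed.
Lemma trN v i x : tr v i (- x) = - tr v i x.
Proof. by rewrite -scaleN1r trZ mulN1r. Qed.

Lemma i_gt0 (i : 'I_d) : (0 < i)%N = (i != o).
Proof. by rewrite lt0n -val_eqE /= o0. Qed.

Variable v : 'rV[R]_d.
Hypothesis v_ax : dot (ut o) v = l0.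

Lemma ax_v : ax v = 1. Proof. by rewrite /ax v_ax divff// gt_eqF. Qed.
Lemma tr_v i : tr v i v = 0. Proof. by rewrite /tr ax_v scale1r subrr dot0r. Qed.

(** The [ut i] with [i > 0] are orthogonal to [ut o], so the product with [ut o] isolates the
    coefficient of [v], and the remainder expands in the other [ut i]. *)
Lemma CylP I h z : Cyl ut v I h z <->
  I (ax z) /\ forall i : 'I_d, (0 < i)%N -> `|tr v i z| <= h.
Proof.
split=> [[y1 [y [Iy yh ->]]]|[Iz Hz]].
  have sumo i : dot (ut i) (\sum_(j < d | (0 < j)%N) y j *: ut j) =
      if (0 < i)%N then y i else 0.
    rewrite dot_sumr (eq_bigr (fun j => y j * (i == j)%:R)); last first.
      by move=> j _; rewrite dotZr onb.
    case: ifPn => i0; last first.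
      rewrite big1// => j j0; rewrite (_ : i == j = false) ?mulr0//.
      by apply/eqP => ij; rewrite ij j0 in i0.
    rewrite (bigD1 i)//= eqxx mulr1 big1 ?addr0// => j /andP[_ ji].
    by rewrite eq_sym (negbTE ji) mulr0.
  have axE : ax (y1 *: v + \sum_(j < d | (0 < j)%N) y j *: ut j) = y1.
    by rewrite /ax dotDr dotZr v_ax sumo i_gt0 eqxx /= addr0 mulfK// gt_eqF.
  rewrite axE; split=> // i i0; rewrite /tr axE addrAC subrr add0r sumo i0.
  exact: yh.
exists (ax z), (fun i => tr v i z); split=> //.
have wE := onb_expand (z - ax z *: v).
rewrite [LHS](_ : z = ax z *: v + (z - ax z *: v)); last by rewrite addrC subrK.
congr (_ + _); rewrite {1}wE (bigD1 o)//= (_ : dot (ut o) _ = 0); last first.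
  by rewrite dotBr dotZr v_ax /ax divfK ?subrr// gt_eqF.
rewrite scale0r add0r.
by apply: eq_bigl => i; rewrite i_gt0.
Qed.

Variable D2 : R.
Hypothesis v_n1 : n1 v <= D2.

(** The axial coordinate is at most [n1 w / l0], and removing that multiple of [v] adds at most
    [D2 * n1 w / l0] to a transverse one. The direction [v] enters only through [D2] and [l0], so
    the constant is uniform. *)
Definition oblique_const := (1 + D2) / l0 + 1.

Lemma oblique_const_ge1 : 1 <= oblique_const.
Proof.
have D20 : 0 <= D2 := le_trans (n1_ge0 v) v_n1.
by rewrite /oblique_const lerDr; apply: divr_ge0; [exact: addr_ge0|exact: ltW].
Qed.

Lemma ax_le w : `|ax w| <= oblique_const * n1 w.
Proof.
have D20 : 0 <= D2 := le_trans (n1_ge0 v) v_n1.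
rewrite /ax normrM normfV (gtr0_norm l0_gt0) /oblique_const mulrDl mul1r.
apply: (@le_trans _ _ ((1 + D2) / l0 * n1 w)); last by rewrite lerDl n1_ge0.
rewrite mulrAC ler_pM2r ?invr_gt0//; apply: le_trans (dot_ut_le _ _) _.
by rewrite ler_peMl ?n1_ge0// lerDl.
Qed.

Lemma tr_le i w : `|tr v i w| <= oblique_const * n1 w.
Proof.
have D20 : 0 <= D2 := le_trans (n1_ge0 v) v_n1.
apply: le_trans (dot_ut_le _ _) _; apply: le_trans (n1D _ _) _.
rewrite n1N n1Z /ax normrM normfV (gtr0_norm l0_gt0) /oblique_const mulrDl mul1r addrC lerD2r.
rewrite mulrAC -[leRHS]mulrAC ler_pM2r ?invr_gt0// mulrC ler_pM ?n1_ge0//.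
  by rewrite (le_trans v_n1)// lerDr.
exact: dot_ut_le.
Qed.

End frame.

(** * Slab crossings *)

Section crossing.
Context (d : nat) (R : realType) (f : 'rV[int]_d -> R).
Hypothesis f_lip : forall z s, `|f (move z s) - f z| <= 1.

Lemma window_or_below (b w : R) z p : b <= f z < b + w -> b + w <= f (path_end z p) ->
  (exists p2 p3, [/\ p = p2 ++ p3,
     forall y, y \in path_vertices z p2 -> b <= f y < b + w
     & b + w - 1 <= f (path_end z p2)]) \/
  (exists q1 q2, [/\ p = q1 ++ q2, (size q2 < size p)%N & f (path_end z q1) < b]).
Proof.
elim: p z => [|s p IH] z fz /= fe; first by exfalso; lra.
have := f_lip z s; rewrite ler_norml => zs.
have [hi|lo] := lerP (b + w) (f (move z s)).
  left; exists [::], (s :: p); split=> //=; last lra.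
  by move=> y; rewrite inE => /eqP ->.
have [lob|hib] := ltrP (f (move z s)) b; first by right; exists [:: s], p.
have [||[p2 [p3 [-> pv pe]]]|[q1 [q2 [-> qs qe]]]] := IH (move z s).
- by rewrite hib.
- by [].
- left; exists (s :: p2), p3; split=> // y.
  by rewrite mem_vertices_cons => /orP[/eqP -> //|]; exact: pv.
- by right; exists (s :: q1), q2; split=> //; rewrite ltnS size_cat leq_addl.
Qed.

(** Strong induction on the length: a path that drops below [b] before passing [b + w] leaves a
    shorter remainder with the same task. Unit steps put the entrance below [b + 1] and the last
    vertex inside at [b + w - 1] or above. *)
Lemma slab_crossing (b w : R) z p : 1 <= w -> f z < b + 1 -> b + w <= f (path_end z p) ->
  exists p1 p2 p3, [/\ p = p1 ++ p2 ++ p3, b <= f (path_end z p1) < b + 1,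
    forall y, y \in path_vertices (path_end z p1) p2 -> b <= f y < b + w
    & b + w - 1 <= f (path_end (path_end z p1) p2)].
Proof.
move=> w1; have [n np] := ubnP (size p); elim: n p np z => [//|n IH] p np z fz fe.
have [bz|zb] := lerP b (f z); last first.
  case: p np fe => [|s p] np /= fe; first by exfalso; lra.
  have := f_lip z s; rewrite ler_norml => zs.
  have [|p1 [p2 [p3 [-> h1 h2 h3]]]] := IH p np (move z s) _ fe; first lra.
  by exists (s :: p1), p2, p3.
have bw : b <= f z < b + w by rewrite bz /=; lra.
have [[p2 [p3 [-> pv pe]]]|[q1 [q2 [pq qs qe]]]] := window_or_below bw fe.
- by exists [::], p2, p3; split=> //; rewrite bz.
- have [|||p1 [p2 [p3 [q2E h1 h2 h3]]]] := IH q2 _ (path_end z q1).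
  + exact: leq_trans qs np.
  + lra.
  + by rewrite -path_end_cat -pq.
  + by exists (q1 ++ p1), p2, p3; rewrite !path_end_cat -catA -q2E.
Qed.

(* Steps change [f] by at most 1, so the part of a path between its last entrance
   in a slab of width [w] and its exit may climb by [w - 2] only. *)
Definition slab_paths (A : set 'rV[int]_d) (b w : R) : set ('rV[int]_d * seq (step d)) :=
  [set zp | (forall y, y \in path_vertices zp.1 zp.2 -> A y /\ b <= f y < b + w) /\
     w - 2 <= f (path_end zp.1 zp.2) - f zp.1].

(** The part of the path before its entrance in the top slab still climbs past the lower ones, so
    the segments charged to different slabs do not overlap and their times add up. *)
Lemma slabs_time (C : R) (t : edge d -> R) A w s n z p :
  bounded_weights C t -> 1 <= w -> f z < 1 ->
  (forall y, y \in path_vertices z p -> A y) -> n%:R * w <= f (path_end z p) ->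
  \sum_(j < n) s * (~~ `[< fast (slab_paths A (j%:R * w) w) s t >])%:R <= path_time t z p.
Proof.
move=> tC w1 fz; elim: n p => [|n IH] p Ap fe.
  by rewrite big_ord0; exact: path_time_ge0 tC.
rewrite -natr1 mulrDl mul1r in fe.
have [//||p1 [p2 [p3 [pE h1 h2 h3]]]] := @slab_crossing (n%:R * w) w z p _ _ fe.
  by rewrite ltr_wpDl// mulr_ge0// (le_trans _ w1).
rewrite pE !path_time_cat big_ord_recr /=; apply: lerD.
  apply: IH; last by case/andP: h1.
  by move=> y yp; apply: Ap; rewrite pE mem_vertices_cat yp.
rewrite -[leLHS]addr0; apply: lerD; last exact: path_time_ge0 tC.
case: asboolP => [_|nf]; first by rewrite mulr0; exact: path_time_ge0 tC.
rewrite mulr1 leNgt; apply/negP => ts; apply: nf.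
exists (path_end z p1, p2); last exact: ltW.
split=> /=; last by move: h1 h3 => /andP[]; lra.
move=> y yp; split; last exact: h2.
by apply: Ap; rewrite pE !mem_vertices_cat yp orbT.
Qed.

Lemma sig_slab_fast A b w s :
  sig (inside [set y | A y /\ b <= f y < b + w])
    [set t : edge d -> R | fast (slab_paths A b w) s t].
Proof. by apply: sig_fast => zp e [pA _]; exact: path_edges_inside pA e. Qed.

End crossing.

(** * Union bounds over subsets of indices *)

Section binomial_tail.
Context (R : realType) (d : nat) (disp : measure_display).
Context (Omega : measurableType disp) (P : probability Omega R).
Variable tau : edge d -> {RV P >-> R}.

(** The predicate [Q] keeps the index sets whose events are independent: all of them for slabs,
    those in one residue class for pieces. *)
Lemma pr_subset_tail n k (B : 'I_n -> set (edge d -> R)) (Q : pred {set 'I_n})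
    (E : set (edge d -> R)) (p : R) : 0 <= p ->
  sig setT E -> (forall i, sig setT (B i)) ->
  (forall S : {set 'I_n}, #|S| = k -> Q S ->
     pr tau (\bigcap_(i in [set` S]) B i) <= p ^+ k) ->
  (forall t, E t -> exists S : {set 'I_n}, [/\ #|S| = k, Q S &
     forall i, i \in S -> B i t]) ->
  pr tau E <= 'C(n, k)%:R * p ^+ k.
Proof.
move=> p0 mE mB prB EB.
rewrite -[n in 'C(n, k)](card_ord n) -card_draws cardE.
have mcap (S : {set 'I_n}) : sig setT (\bigcap_(i in [set` S]) B i).
  rewrite (_ : [set` S] = [set` enum S]).
    by apply: sig_bigI => i _.
  by apply/seteqP; split=> i; rewrite /= mem_enum.
(* An index set outside [Q] contributes the empty event, so the union can run over all sets of size
   [k]. *)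
apply: (pr_union_bound (F := fun S : {set 'I_n} => if Q S then
   \bigcap_(i in [set` S]) B i else set0)) => //.
- move=> S _; case: ifP => _ //; exact: sigma_algebra0.
- move=> S; rewrite mem_enum inE => /eqP Sk; case: ifPn => QS; first exact: prB.
  by rewrite /pr preimage_set0 measure0 exprn_ge0.
- move=> t /EB[S [Sk QS BS]]; exists S; first by rewrite /= mem_enum inE Sk.
  by rewrite QS => i; exact: BS.
Qed.

End binomial_tail.

Lemma l1_ball_finite d M : exists s : seq 'rV[int]_d, forall m, (l1 m <= M)%N -> m \in s.
Proof.
elim: M => [|M [s IH]].
  by exists [:: 0] => m; rewrite leqn0 => /eqP/l1_eq0 ->; rewrite inE.
exists (s ++ [seq move z e | z <- s, e <- enum {: step d}]) => m lm.
have [mM|Mm] := leqP (l1 m) M; first by rewrite mem_cat IH.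
have [|e em] := @l1_step _ m; first by rewrite -lt0n (leq_trans _ Mm).
rewrite mem_cat; apply/orP; right; apply/allpairsP; exists (m - move 0 e, e).
split; rewrite /= ?mem_enum//; first by apply: IH; rewrite -ltnS em.
by rewrite -[m - move 0 e]add0r move_shift addrC subrK.
Qed.

Lemma eventually_seq (T : eqType) (s : seq T) (Q : T -> nat -> Prop) :
  (forall x, x \in s -> exists N0, forall N, (N0 <= N)%N -> Q x N) ->
  exists N0, forall N, (N0 <= N)%N -> forall x, x \in s -> Q x N.
Proof.
elim: s => [|x s IH] H; first by exists 0%N.
have [N1 H1] := IH (fun y ys => H y (mem_behead (s := x :: s) ys)).
have [N2 H2] := H x (mem_head _ _).
exists (maxn N1 N2) => N; rewrite geq_max => /andP[NN1 NN2] y.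
by rewrite inE => /orP[/eqP ->|]; [exact: H2|exact: H1].
Qed.

Lemma exists_subset_card (T : finType) (A : {set T}) k : (k <= #|A|)%N ->
  exists2 S : {set T}, S \subset A & #|S| = k.
Proof.
move=> kA; exists [set x in take k (enum A)].
  by apply/fintype.subsetP => x; rewrite inE => /mem_take; rewrite mem_enum.
rewrite cardsE; have /card_uniqP -> : uniq (take k (enum A)) by rewrite take_uniq// enum_uniq.
by rewrite size_take -cardE; case: ltngtP kA.
Qed.

Lemma le_of_add_double a b c : (a + b = 2 * c)%N -> (b < c)%N -> (c <= a)%N.
Proof. lia. Qed.

Lemma bin_le_exp2 n k : ('C(n, k) <= 2 ^ n)%N.
Proof.
rewrite -[n in 'C(n, k)](card_ord n) -card_draws -[in (2 ^ n)%N](card_ord n) -cardsT -card_powerset.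
by apply: subset_leq_card; apply/fintype.subsetP => S _; rewrite powersetE finset.subsetT.
Qed.

(** * Fast slab crossings and straying paths are unlikely *)

Section slabs.
Context (R : realType) (d : nat) (disp : measure_display).
Context (Omega : measurableType disp) (P : probability Omega R).
Variable tau : edge d -> {RV P >-> R}.
Hypothesis indep : mutually_independent tau.
Hypothesis ident : identically_distributed tau.
Variable C : R.
Hypothesis C_gt0 : 0 < C.
Hypothesis tau_ge0 : forall e w, 0 <= tau e w.
Hypothesis tau_le : forall e, P [set w | tau e w <= C] = 1%E.
Variables (mu : 'rV[R]_d -> R) (mu_tc : time_constant tau mu).
Variable ut : 'I_d -> 'rV[R]_d.
Hypothesis onb : orthonormal_basis ut.
Variable o : 'I_d.
Hypothesis o0 : o = 0%N :> nat.
Variable l0 : R.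
Hypothesis l0_gt0 : 0 < l0.
Variable D2 : R.
Hypothesis D2_ge0 : 0 <= D2.

(** The sign handles both ends of the cylinder. Without division by [l0], a lattice step changes the
    height by at most 1, as the slab crossings require. *)
Definition sheight (sg : R) (z : 'rV[int]_d) : R := sg * dot (ut o) (to_real R z).

Lemma sheight_le sg z z' : `|sg| = 1 ->
  `|sheight sg z - sheight sg z'| <= (l1 (z - z'))%:R.
Proof.
move=> sg1; rewrite /sheight -mulrBr -dotBr -to_realN -to_realD normrM sg1 mul1r.
by rewrite -n1_to_real dot_ut_le.
Qed.

Lemma sheight_lip sg z s : `|sg| = 1 -> `|sheight sg (move z s) - sheight sg z| <= 1.
Proof. by move=> sg1; have := sheight_le (move z s) z sg1; rewrite l1_move. Qed.

(** A slab as thick as the cylinder is wide cuts out a piece of diameter comparable to [w]: the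
    axial part contributes [D2 / l0], and each of the [d] basis vectors, of [n1] norm at most [d],
    contributes [d]. *)
Lemma slab_diameter v sg b w y : dot (ut o) v = l0 -> n1 v <= D2 -> `|sg| = 1 ->
  0 <= w -> lat (Cyl ut v setT w) y -> b <= sheight sg y < b + w ->
  n1 (to_real R y - (sg * b / l0) *: v) <= (D2 / l0 + d%:R * d%:R) * w.
Proof.
move=> vl vD sg1 w0 /(CylP onb o0 l0_gt0 vl)[_ ytr] yb.
have sg2 : sg * sg = 1 by rewrite -expr2 -real_normK ?num_real// sg1 expr1n.
set q := _ - _.
have qax : `|ax ut o l0 q| <= w / l0.
  rewrite /q axD axN axZ (ax_v l0_gt0 vl) mulr1 /ax -mulrBl normrM normfV (gtr0_norm l0_gt0).
  rewrite ler_pM2r ?invr_gt0//.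
  have -> : dot (ut o) (to_real R y) - sg * b = sg * (sheight sg y - b).
    by rewrite /sheight mulrBr mulrA sg2 mul1r.
  by rewrite normrM sg1 mul1r ger0_norm ?subr_ge0; lra.
have qtr (i : 'I_d) : (0 < i)%N -> `|tr ut o l0 v i q| <= w.
  by move=> i0; rewrite /q trD trN trZ (tr_v l0_gt0 vl) mulr0 subr0 ytr.
have e1 i : n1 (ut i) <= d%:R.
  by apply: le_trans (n1_le_enorm _) _; rewrite /enorm onb eqxx sqrtr1 mulr1.
have -> : q = ax ut o l0 q *: v + \sum_i tr ut o l0 v i q *: ut i.
  by rewrite -[\sum_i _](onb_expand onb) addrC subrK.
apply: le_trans (n1D _ _) _; rewrite mulrDl; apply: lerD.
  by rewrite n1Z mulrAC -mulrA mulrC; apply: ler_pM; rewrite ?n1_ge0// mulrC.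
apply: (@le_trans _ _ (\sum_(i < d) w * d%:R)); last first.
  by rewrite sumr_const card_ord -[_ *+ d]mulr_natl mulrA mulrAC.
have nsum (I : Type) (r : seq I) (F : I -> 'rV[R]_d) :
    n1 (\sum_(i <- r) F i) <= \sum_(i <- r) n1 (F i).
  elim/big_ind2: _ => [|x x' y1 y1' h h'|//].
    by rewrite -(scale0r 0) n1Z normr0 mul0r.
  exact: le_trans (n1D _ _) (lerD h h').
apply: le_trans (nsum _ _ _) _; apply: ler_sum => i _; rewrite n1Z.
apply: ler_pM; rewrite ?n1_ge0//; have [io|io] := eqVneq i o.
  rewrite io /tr dotBr dotZr vl /ax divfK ?subrr ?normr0//; exact: lt0r_neq0.
by apply: qtr; rewrite (i_gt0 o0).
Qed.

Let mu_norm : is_norm mu := proj1 mu_tc.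

(* A fast crossing yields two points of the mesh [c0 + N Z^d], [N ~ w / q], at
   distance about [w] and with passage time at most half of its typical value.
   The number of such pairs depends only on [q], so the law of large numbers
   and a union bound apply once [w] is large. *)
Lemma pr_fast_slab (p0 : R) : 0 < p0 -> exists c W0, [/\ 0 < c, 1 <= W0 &
  forall w v sg b, W0 <= w -> dot (ut o) v = l0 -> n1 v <= D2 -> `|sg| = 1 ->
  pr tau [set t | fast (slab_paths (sheight sg) (lat (Cyl ut v setT w)) b w) (c * w) t]
    <= p0].
Proof.
move=> p00; have [k0 k00 muk0] := mu_ge mu_norm.
have d_gt0 : 0 < d%:R :> R by rewrite ltr0n; case: (o) => i; case: (d).
pose k := k0 / d%:R; have k_gt0 : 0 < k by rewrite divr_gt0.
have muk x : k * n1 x <= mu x.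
  apply: le_trans (muk0 x); rewrite /k mulrAC ler_pdivrMr// -mulrA ler_pM2l//.
  by rewrite mulrC n1_le_norm.
(* A budget per unit of [N]: rounding both endpoints to the mesh costs [2 C d] in time and, with the
   2 lost in [slab_paths], at most [2 + 2 d] in distance. The inequality is [2 (2 C d + (k / 8) 2 q)
   <= k (q - 2 - 2 d)] rearranged. *)
have [q q_gt0 qP] : exists2 q : nat, (0 < q)%N &
    2 * C * d%:R + k * (1 + d%:R) <= k * q%:R / 4.
  exists (Num.bound (4 / k * (2 * C * d%:R + k * (1 + d%:R)))).+1 => //.
  have pos : 0 <= 4 / k * (2 * C * d%:R + k * (1 + d%:R)).
    by rewrite !(mulr_ge0, addr_ge0, invr_ge0, ltW C_gt0, ltW k_gt0, ler0n, ler01).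
  have := archi_boundP pos; set N := Num.bound _ => HN.
  rewrite -(ler_pM2l (x := 4 / k)) ?divr_gt0//; apply: le_trans (ltW HN) _.
  have -> : 4 / k * (k * N.+1%:R / 4) = N.+1%:R :> R by field; apply/lt0r_neq0.
  by rewrite ler_nat.
pose C1 := D2 / l0 + d%:R * d%:R + d%:R.
have C1_ge0 : 0 <= C1 by rewrite /C1 !addr_ge0 ?mulr_ge0 ?invr_ge0// ltW.
(* Points of the slab are within [C1 w] of [c0], and [w <= 2 q N]; the final [d] is the rounding to
   the mesh. *)
have [s sP] := l1_ball_finite d (Num.bound (C1 * (2 * q%:R) + d%:R)).
pose good (mm : 'rV[int]_d * 'rV[int]_d) :=
  (0 < mu (to_real R (mm.2 - mm.1))) &&
  (2 * (2 * C * d%:R + k / 8 * (2 * q%:R)) <= mu (to_real R (mm.2 - mm.1))).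
pose pairs := [seq mm <- [seq (m, m') | m <- s, m' <- s] | good mm].
(* The successor keeps the denominator positive when no pair is good. *)
pose r := p0 / (size pairs).+1%:R.
have r_gt0 : 0 < r by rewrite divr_gt0.
have [N0 N0P] : exists N0, forall N, (N0 <= N)%N -> forall mm, mm \in pairs ->
    pr tau [set t | connects t setT 0 ((mm.2 - mm.1) *+ N)
      (N%:R * mu (to_real R (mm.2 - mm.1)) / 2)] <= r.
  apply: eventually_seq => mm; rewrite mem_filter => /andP[/andP[mm0 _] _].
  exact: (pr_fast_lln mu_tc).
(* This threshold forces [N0 < N], where [N] is the integer part of [w / q]. *)
exists (k / 8), (q%:R * N0.+1%:R); split; first by rewrite divr_gt0.
  by rewrite -natrM ler1n muln_gt0 q_gt0.
move=> w v sg b ww vl vD sg1.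
pose N := Num.truncn (w / q%:R).
have q0 : 0 < q%:R :> R by rewrite ltr0n.
have w1 : 1 <= w by apply: le_trans ww; rewrite -natrM ler1n muln_gt0 q_gt0.
have w0 : 0 <= w by lra.
have /andP[Nw wN] : N%:R <= w / q%:R < N.+1%:R by apply: truncn_itv; rewrite divr_ge0.
have N0N : (N0 < N)%N.
  by rewrite /N truncn_gt_nat ler_pdivlMr// mulrC.
have N_gt0 : 0 < N%:R :> R by rewrite ltr0n (leq_trans _ N0N).
have {}Nw : N%:R * q%:R <= w by rewrite -ler_pdivlMr.
have N2 : N.+1%:R <= N%:R * 2 :> R.
  by rewrite -natrM ler_nat muln2 -addnn -addn1 leq_add2l (leq_trans _ N0N).
have {}wN : w <= N%:R * (2 * q%:R).
  apply: (@le_trans _ _ (N.+1%:R * q%:R)); first by rewrite -ler_pdivrMr// ltW.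
  by rewrite mulrA ler_pM2r.
pose c0 := floor_pt ((sg * b / l0) *: v).
pose A := lat (Cyl ut v setT w).
set F := [set t | _].
have mesh y : A y -> b <= sheight sg y < b + w ->
    exists2 m, m \in s & (l1 (y - (c0 + m *+ N)) <= d * N)%N.
  move=> Ay yb; pose m := floor_pt (N%:R^-1 *: to_real R (y - c0)).
  have rel : n1 (to_real R (y - c0)) <= C1 * w.
    have := slab_diameter vl vD sg1 w0 Ay yb => H.
    have -> : to_real R (y - c0) =
        (to_real R y - (sg * b / l0) *: v) + frac_pt ((sg * b / l0) *: v).
      by rewrite /frac_pt addrA subrK to_realD to_realN.
    apply: le_trans (n1D _ _) _; rewrite {1}/C1 mulrDl; apply: lerD => //.
    by apply: le_trans (n1_frac _) _; rewrite ler_peMr// ltW.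
  have err : n1 (to_real R (y - c0) - N%:R *: to_real R m) <= d%:R * N%:R.
    have -> : to_real R (y - c0) - N%:R *: to_real R m =
        N%:R *: frac_pt (N%:R^-1 *: to_real R (y - c0)).
      by rewrite /frac_pt scalerBr scalerA divff ?scale1r// gt_eqF.
    by rewrite n1Z gtr0_norm// mulrC ler_pM2r// n1_frac.
  exists m; last first.
    rewrite -(ler_nat R) natrM -n1_to_real opprD addrA to_realD to_realN to_realMn.
    exact: err.
  apply: sP; rewrite -(ler_nat R) -n1_to_real.
  apply: le_trans (ltW (archi_boundP _)); last first.
    by rewrite addr_ge0// mulr_ge0// mulr_ge0// ltW.
  rewrite -(ler_pM2l N_gt0) mulrDr.
  rewrite (_ : N%:R * _ = n1 (N%:R *: to_real R m)); last by rewrite n1Z gtr0_norm.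
  have -> : N%:R *: to_real R m = to_real R (y - c0) -
     (to_real R (y - c0) - N%:R *: to_real R m) by rewrite opprB addrC subrK.
  apply: le_trans (n1D _ _) _; rewrite n1N; apply: lerD; last by rewrite mulrC.
  by apply: le_trans rel _; rewrite mulrCA ler_wpM2l.
have mF : sig setT F.
  by apply: sig_mono (@sig_slab_fast _ _ _ _ _ _ _).
pose G (mm : 'rV[int]_d * 'rV[int]_d) := [set t : edge d -> R |
  connects t setT (0 + (c0 + mm.1 *+ N)) ((mm.2 - mm.1) *+ N + (c0 + mm.1 *+ N))
    (N%:R * mu (to_real R (mm.2 - mm.1)) / 2)].
have mG mm : sig setT (G mm) by exact: sigT_connects.
pose UG := \bigcup_(mm in [set` pairs]) G mm.
have mUG : sig setT UG.
  rewrite /UG (_ : \bigcup_(mm in _) _ = ~` \bigcap_(mm in [set` pairs]) ~` G mm).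
    by apply: sigC; apply: sig_bigI => mm _; exact: sigC.
  by rewrite setC_bigcap; apply: eq_bigcupr => mm _; rewrite setCK.
apply: (@le_trans _ _ (pr tau UG)).
  apply: (pr_le tau_ge0 tau_le) => // t tC [[z p] [/= pA pe] ptime].
  set z' := path_end z p in pe.
  have [Az zb] := pA _ (mem_start z p); have [Az' zb'] := pA _ (mem_end z p).
  have [m ms ml] := mesh _ Az zb; have [m' ms' ml'] := mesh _ Az' zb'.
  have mlR : (l1 (z - (c0 + m *+ N)))%:R <= d%:R * N%:R :> R by rewrite -natrM ler_nat.
  have mlR' : (l1 (z' - (c0 + m' *+ N)))%:R <= d%:R * N%:R :> R by rewrite -natrM ler_nat.
  (* The distance is read off the height alone, which grows by at least [w - 2] and is 1-Lipschitz
     for [l1]. *)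
  have far : q%:R - 2 - 2 * d%:R <= n1 (to_real R (m' - m)).
    rewrite -(ler_pM2l N_gt0).
    rewrite (_ : N%:R * n1 _ = (l1 ((c0 + m' *+ N) - (c0 + m *+ N)))%:R); last first.
      rewrite opprD addrACA subrr add0r -mulrnBl -n1_to_real to_realMn.
      by rewrite n1Z gtr0_norm.
    have := sheight_le (c0 + m' *+ N) (c0 + m *+ N) sg1.
    have := sheight_le z (c0 + m *+ N) sg1.
    have := sheight_le z' (c0 + m' *+ N) sg1.
    rewrite !ler_norml => /andP[_ h1] /andP[h2 _] /andP[_ h3].
    have N1 : 1 <= N%:R :> R by rewrite ler1n (leq_trans _ N0N).
    rewrite !mulrBr; lra.
  have mubig : k * (q%:R - 2 - 2 * d%:R) <= mu (to_real R (m' - m)).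
    by apply: le_trans (muk _); rewrite ler_pM2l.
  have goodm : 2 * (2 * C * d%:R + k / 8 * (2 * q%:R)) <= mu (to_real R (m' - m)).
    by apply: le_trans mubig; lra.
  exists (m, m').
    rewrite /= mem_filter; apply/andP; split; last by apply/allpairsP; exists (m, m').
    rewrite /good /= goodm andbT; apply: lt_le_trans goodm.
    rewrite mulr_gt0//; apply: ltr_wpDl; first by rewrite !mulr_ge0// ltW.
    by rewrite !mulr_gt0// invr_gt0.
  rewrite /G /= add0r.
  rewrite (_ : (m' - m) *+ N + _ = c0 + m' *+ N); last first.
    by rewrite mulrnBl addrCA subrK.
  have C0 := ltW C_gt0.
  have line a a' : connects t setT a a' (C * (l1 (a' - a))%:R) by exact: connects_line.
  have piece : connects t setT z z' (k / 8 * w) by apply/connectsP; exists p.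
  apply: connects_sub (connects_cat (connects_cat (line _ z) piece) (line _ _)) => //.
  rewrite -(l1N (c0 + _ - _)) opprB.
  have h1 := ler_wpM2l C0 mlR; have h2 := ler_wpM2l C0 mlR'.
  have h3 : k / 8 * w <= k / 8 * (N%:R * (2 * q%:R)) by rewrite ler_pM2l// divr_gt0.
  have h4 : N%:R * (2 * (2 * C * d%:R + k / 8 * (2 * q%:R))) <=
    N%:R * mu (to_real R (m' - m)) by rewrite ler_pM2l.
  lra.
apply: le_trans (pr_union_bound mUG (fun mm _ => mG mm) (b := r) _ _) _ => //.
- move=> mm mmp; have := N0P N (ltnW N0N) mm mmp.
  rewrite -(pr_connects_shift indep ident _ (c0 + mm.1 *+ N)).
  exact: id.
- by [].
- by rewrite /r mulrCA ler_piMr ?ltW// ltr_pdivrMr// mul1r ltr_nat.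
Qed.

Definition stray_paths (A : set 'rV[int]_d) (sg h : R) : set ('rV[int]_d * seq (step d)) :=
  [set zp | [/\ zp.1 = 0, forall y, y \in path_vertices 0 zp.2 -> A y
    & h <= sheight sg (path_end 0 zp.2)]].

(* A path climbing [2 k] slabs in time less than [k] times the slow crossing time
   crosses [k] of them fast. *)
Lemma pr_stray : exists c W0, [/\ 0 < c, 1 <= W0 &
  forall w v sg k s, W0 <= w -> dot (ut o) v = l0 -> n1 v <= D2 -> `|sg| = 1 ->
  s < c * w * k%:R ->
  pr tau [set t | fast (stray_paths (lat (Cyl ut v setT w)) sg ((2 * k)%:R * w)) s t]
    <= 4^-1 ^+ k].
Proof.
(* There are at most [4 ^ k] choices of [k] fast slabs among [2 k], so a probability [16^-1] per
   slab leaves [4^-1 ^+ k]. *)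
have p16 : (0 : R) < 16^-1 by rewrite invr_gt0.
have [c [W0 [c0 W01 slab]]] :=
  pr_fast_slab p16.
exists c, W0; split=> // w v sg k s Ww vl vD sg1 sk.
set E := [set t | _]; pose A := lat (Cyl ut v setT w).
have w1 : 1 <= w by exact: le_trans Ww.
have lip z s' := sheight_lip z s' sg1.
pose B (j : 'I_(2 * k)) := [set t : edge d -> R |
  fast (slab_paths (sheight sg) A (j%:R * w) w) (c * w) t].
have mE : sig setT E by apply: sig_fast.
have mB j : sig setT (B j) by apply: sig_mono (@sig_slab_fast _ _ _ _ _ _ _).
have mbd := @sig_bounded_weights R d C.
apply: (@le_trans _ _ (pr tau (E `&` bounded_weights C))).
  by apply: (pr_le tau_ge0 tau_le) => //; exact: sigI.
apply: le_trans (@pr_subset_tail _ _ _ _ _ _ (2 * k) k B predT _ 16^-1 _ _ mB _ _) _.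
- exact: ltW.
- exact: sigI.
- move=> S Sk _; rewrite (_ : [set` S] = [set` enum S]); last first.
    by apply/seteqP; split=> i; rewrite /= mem_enum.
  have sizeS : size (enum S) = k by rewrite -cardE.
  rewrite -[in leRHS]sizeS; apply: (pr_indep_seq indep (S := fun j : 'I_(2 * k) =>
    inside [set y | A y /\ j%:R * w <= sheight sg y < j%:R * w + w])).
  + exact: enum_uniq.
  (* Slabs are half-open, so the first endpoint of an edge determines its slab. *)
  + move=> i j e _ _ [[_ ei] _] [[_ ej] _]; apply/val_inj; apply/eqP.
    have H (a b : nat) : a%:R * w <= sheight sg e.1 ->
        sheight sg e.1 < b%:R * w + w -> (a <= b)%N.
      move=> h1 h2; have := le_lt_trans h1 h2.
      by rewrite -[X in _ + X]mul1r -mulrDl natr1 ltr_pM2r ?(lt_le_trans ltr01)// ltr_nat ltnS.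
    case/andP: ei => i1 i2; case/andP: ej => j1 j2.
    by rewrite eqn_leq (H _ _ i1 j2) (H _ _ j1 i2).
  + by move=> i _; exact: sig_slab_fast.
  + by move=> i _; apply: slab.
- move=> t [[[_ p] [/= -> Ap pe] pt] tC].
  pose Fs := [set j : 'I_(2 * k) | `[< B j t >]]%SET.
  (* Otherwise at least [k] slabs are slow and already cost [c * w * k], more than [s]. *)
  have kF : (k <= #|Fs|)%N.
    rewrite leqNgt; apply/negP => Fk.
    have z1 : sheight sg (0 : 'rV[int]_d) < 1.
      rewrite /sheight (_ : to_real R 0 = 0) ?dot0r ?mulr0//.
      by apply/rowP => i; rewrite !mxE.
    have := @slabs_time d R (sheight sg) lip C t A w (c * w) (2 * k) 0 p tC w1 z1 Ap pe.
    rewrite -mulr_sumr -natr_sum => H.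
    have slow : (k <= \sum_(j < 2 * k) ~~ `[< B j t >])%N.
      have : (\sum_(j < 2 * k) ~~ `[< B j t >] + #|Fs| = 2 * k)%N.
        rewrite -sum1_card [X in (_ + X)%N]big_mkcond -big_split /=.
        transitivity (\sum_(j < 2 * k) 1)%N; last by rewrite sum1_card card_ord.
        by apply: eq_bigr => j _; rewrite inE; case: asboolP.
      by move=> e2k; exact: le_of_add_double e2k Fk.
    move: (le_lt_trans (le_trans H pt) sk); rewrite ltr_pM2l ?mulr_gt0//; last lra.
    by rewrite ltr_nat ltnNge slow.
  have [S SF Sk] := exists_subset_card kF; exists S; split=> // i iS.
  by have := fintype.subsetP SF i iS; rewrite inE => /asboolP.
- apply: (@le_trans _ _ ((2 ^ (2 * k))%:R * 16^-1 ^+ k)).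
    by rewrite ler_wpM2r ?exprn_ge0 ?ler_nat ?bin_le_exp2// ltW.
  rewrite natrX exprM -exprMn.
  by rewrite (_ : 2%:R ^+ 2 * 16^-1 = 4^-1 :> R)//; field.
Qed.

End slabs.

(** * Polynomial scales *)

Section powers.
Context (R : realType).
Implicit Types a b M : R.

Lemma near_powR a M : 0 < a -> \forall L \near +oo, M <= L `^ a.
Proof.
move=> a0; near=> L.
have L0 : (Num.max M 0) `^ a^-1 <= L by near: L; apply: nbhs_pinfty_ge; exact: num_real.
apply: (@le_trans _ _ (Num.max M 0)); first by rewrite le_max lexx.
have M0 : 0 <= Num.max M 0 by rewrite le_max lexx orbT.
rewrite -[leLHS]powRr1// -(mulVf (lt0r_neq0 a0)) powRrM.
apply: ge0_ler_powR => //; rewrite ?nnegrE ?powR_ge0//; first exact: ltW.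
Unshelve. all: by end_near. Qed.

Lemma powR_add L a b : 0 < L -> L `^ (a + b) = L `^ a * L `^ b.
Proof. by move=> L0; rewrite powRD// lt0r_neq0// implybT. Qed.

Lemma near_ge M : \forall L \near +oo, M <= L.
Proof. by apply: nbhs_pinfty_ge; exact: num_real. Qed.

Lemma near_powR_lt a b M : a < b -> \forall L \near +oo, M * L `^ a <= L `^ b.
Proof.
move=> ab; near=> L; have L0 : 0 < L by near: L; apply: nbhs_pinfty_gt; exact: num_real.
rewrite -[b](subrK a) powR_add// ler_pM2r ?powR_gt0//.
by near: L; apply: near_powR; rewrite subr_gt0.
Unshelve. all: by end_near. Qed.

End powers.

Lemma mem_vertices_split d (z y : 'rV[int]_d) p : y \in path_vertices z p ->
  exists p1 p2, p = p1 ++ p2 /\ path_end z p1 = y.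
Proof.
elim: p z => [|s p IH] z; first by rewrite inE => /eqP ->; exists [::], [::].
rewrite mem_vertices_cons => /orP[/eqP ->|/IH[p1 [p2 [-> pe]]]].
  by exists [::], (s :: p).
by exists (s :: p1), p2.
Qed.

Lemma Cyl_scale (R : realType) d (ut : 'I_d -> 'rV[R]_d) v L h : 0 < L ->
  Cyl ut (L *: v) setT h = Cyl ut v setT h.
Proof.
move=> L0; apply/seteqP; split=> x [y1 [y [_ yh ->]]].
  by exists (y1 * L), y; rewrite -scalerA.
by exists (y1 / L), y; rewrite scalerA divfK ?gt_eqF.
Qed.

(** A reciprocal is enough, because [k] will be at least of the order of a positive power of [L]. *)
Lemma quarter_exp_le (R : realType) k : (4^-1 : R) ^+ k <= k.+1%:R^-1.
Proof.
rewrite exprVn lef_pV2 ?posrE ?exprn_gt0// -natrX ler_nat.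
elim: k => // k IH; rewrite expnS; lia.
Qed.

Lemma bin_le_exp n k : ('C(n, k) <= n ^ k)%N.
Proof.
apply: (@leq_trans (n ^_ k)); first by rewrite -bin_ffact leq_pmulr ?fact_gt0.
rewrite ffact_prod -[k in (n ^ k)%N](card_ord k) -prod_nat_const.
by apply: leq_prod => i _; exact: leq_subr.
Qed.

(* Pieces whose indices agree modulo a large constant are disjoint. *)
Lemma same_residue_subset m M k (A : {set 'I_m}) : (0 < k)%N -> (k * M.+1 <= #|A|)%N ->
  exists S : {set 'I_m}, [/\ S \subset A, #|S| = k &
    forall i j, i \in S -> j \in S -> (i %% M.+1 = j %% M.+1)%N].
Proof.
move=> k0 kA; pose cl (r : 'I_M.+1) := finset (fun i : 'I_m => (i \in A) && (i %% M.+1 == r)%N).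
have [r kr] : exists r, (k <= #|cl r|)%N.
  apply: contrapT => H.
  have small r : (#|cl r| <= k.-1)%N.
    by rewrite -ltnS prednK// ltnNge; apply/negP => kr; apply: H; exists r.
  have : (#|A| <= M.+1 * k.-1)%N.
    rewrite -sum1_card (partition_big (fun i : 'I_m => inord (i %% M.+1) : 'I_M.+1) predT)//=.
    rewrite -[in leqRHS](card_ord M.+1) -sum_nat_const; apply: leq_sum => r _.
    apply: leq_trans (small r); rewrite -sum1_card; apply: eq_leq; apply: eq_bigl => i.
    rewrite inE; case: (i \in A) => //=.
    by rewrite -val_eqE /= inordK// ltn_pmod.
  move=> /(leq_trans kA); rewrite mulnC leq_mul2l /= => /leq_trans.
  by move=> /(_ k.-1 (leqnn _)); rewrite -ltnS prednK// ltnn.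
have [S SA Sk] := exists_subset_card kr; exists S; split=> //.
  by apply: fintype.subset_trans SA _; apply/fintype.subsetP => i; rewrite inE => /andP[].
move=> i j iS jS; have := fintype.subsetP SA i iS; have := fintype.subsetP SA j jS.
by rewrite !inE => /andP[_ /eqP ->] /andP[_ /eqP ->].
Qed.

(** * Bookkeeping of exponents when [K] is cut into [m] pieces of length [L] *)

Section scales.
Context (R : realType).
Implicit Types (K L m k : R).

Lemma near_extract (Q : R -> Prop) : (\forall L \near +oo, Q L) ->
  exists M, forall L, M < L -> Q L.
Proof. by move=> [M [_ H]]; exists M. Qed.

(** One Taylor term of the exponential, of degree above [|b| / a], beats the power. *)
Lemma near_expR (a b M : R) : 0 < a -> \forall K \near +oo, M * K `^ b <= expR (K `^ a).
Proof.
move=> a0; pose n := Num.bound (`|b| / a).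
have bn : b < a * n.+1%:R.
  rewrite mulrC -ltr_pdivrMr//; apply: le_lt_trans (_ : `|b| / a < _).
    by rewrite ler_pM2r ?invr_gt0// ler_norm.
  apply: lt_le_trans (archi_boundP _) _; first by rewrite divr_ge0// ltW.
  by rewrite ler_nat.
near=> K.
have K0 : 0 <= K by near: K; exact: near_ge.
have H : (M * n.+1`!%:R) * K `^ b <= K `^ (a * n.+1%:R).
  by near: K; exact: near_powR_lt.
apply: (@le_trans _ _ (1 + (K `^ a) ^+ n.+1 / n.+1`!%:R)); last first.
  exact: expR_ge1Dxn (powR_ge0 _ _).
rewrite -powR_mulrn ?powR_ge0// -powRrM ler_wpDl// ler_pdivlMr ?ltr0n ?fact_gt0//.
by rewrite mulrAC.
Unshelve. all: by end_near. Qed.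

Variable eta : R.
Hypotheses (eta0 : 0 < eta) (eta1 : eta < 1).

(** The factor 2 leaves room for rounding the number of pieces up to an integer. *)
Definition scale K m L := [/\ K `^ eta <= m, m <= 2 * K `^ eta & m * L = K].

Lemma scale_bounds K m L : 1 <= K -> scale K m L ->
  [/\ 0 < L, K `^ (1 - eta) <= 2 * L, L <= K `^ (1 - eta), L <= K & 1 <= K `^ eta].
Proof.
move=> K1 [m1 m2 mL]; have K0 : 0 < K by rewrite (lt_le_trans ltr01).
have Ke : 1 <= K `^ eta by rewrite -(powRr0 K) ler_powR// ltW.
have m0 : 0 < m by rewrite (lt_le_trans ltr01)// (le_trans Ke).
have L0 : 0 < L by rewrite -(pmulr_rgt0 _ m0) mL.
have KE : K = K `^ eta * K `^ (1 - eta) by rewrite -powR_add// addrC subrK powRr1// ltW.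
have Ke0 : 0 < K `^ eta by exact: powR_gt0.
split=> //.
- rewrite -(ler_pM2l Ke0) -KE mulrCA mulrA.
  by have := ler_wpM2r (ltW L0) m2; rewrite mL.
- rewrite -(ler_pM2l Ke0) -KE.
  by have := ler_wpM2r (ltW L0) m1; rewrite mL.
- by rewrite -mL ler_peMl ?(ltW L0)// (le_trans Ke).
Qed.

Lemma scale_powL K m L a : 0 <= a -> 1 <= K -> scale K m L ->
  L `^ a <= K `^ ((1 - eta) * a).
Proof.
move=> a0 K1 /(scale_bounds K1)[L0 _ L2 _ _]; rewrite powRrM.
by apply: ge0_ler_powR; rewrite ?nnegrE ?powR_ge0// ltW.
Qed.

Lemma scale_powL_ge K m L a : 0 <= a -> 1 <= K -> scale K m L ->
  K `^ ((1 - eta) * a) <= 2 `^ a * L `^ a.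
Proof.
move=> a0 K1 /(scale_bounds K1)[L0 L1 _ _ _]; rewrite powRrM -powRM ?(ltW L0)//.
by apply: ge0_ler_powR; rewrite ?nnegrE ?powR_ge0// mulr_ge0// ltW.
Qed.

Lemma scale_m1 K m L : 1 <= K -> scale K m L -> m + 1 <= 3 * K `^ eta.
Proof. by move=> K1 KL; have [_ _ _ _ ?] := scale_bounds K1 KL; case: KL => *; lra. Qed.

(** Along the axis the last piece overshoots by [rho * L] and rounding drifts by a constant per
    piece; both are of lower order than [K]. *)
Lemma scale_long (rho G : R) : 0 <= rho -> 0 <= G ->
  \forall K \near +oo, forall m L, scale K m L ->
    K + rho * L + 2 * G * (m + 1) <= 2 * K.
Proof.
move=> r0 G0; have e1 : 1 - eta < 1 by rewrite ltrBlDr ltrDl.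
near=> K => m L KL; have K1 : 1 <= K by near: K; exact: near_ge.
have h1 : (2 * rho) * K `^ (1 - eta) <= K `^ 1 by near: K; exact: near_powR_lt.
have h2 : (12 * G) * K `^ eta <= K `^ 1 by near: K; exact: near_powR_lt.
have K0 : 0 <= K by rewrite (le_trans ler01).
rewrite powRr1 // in h1 h2.
have [_ _ L2 _ _] := scale_bounds K1 KL; have m1 := scale_m1 K1 KL.
have h3 := ler_wpM2l r0 L2; have h4 := ler_wpM2l G0 m1; 
by move: h1 h2 h3 h4; move: (K `^ _) (K `^ _) => x y; lra.
Unshelve. all: by end_near. Qed.

(** Across the axis the drift, of order [K^eta], must fit in the width [K^w], hence [eta < w]. *)
Lemma scale_wide (w G : R) : 0 <= G -> eta < w ->
  \forall K \near +oo, forall m L, scale K m L ->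
    L `^ w + 2 * G * (m + 1) <= K `^ w.
Proof.
move=> G0 ew; have e1 : (1 - eta) * w < w.
  by rewrite mulrBl mul1r ltrBlDr ltrDl mulr_gt0// (lt_trans eta0).
have w0 : 0 <= w by rewrite ltW// (lt_trans eta0).
near=> K => m L KL; have K1 : 1 <= K by near: K; exact: near_ge.
have h1 : 2 * K `^ ((1 - eta) * w) <= K `^ w by near: K; exact: near_powR_lt.
have h2 : (12 * G) * K `^ eta <= K `^ w by near: K; exact: near_powR_lt.
have m1 := scale_m1 K1 KL; have h3 := scale_powL w0 K1 KL.
have h4 := ler_wpM2l G0 m1; 
by move: h1 h2 h3 h4; move: (K `^ w) (K `^ _) (K `^ _) => x y z; lra.
Unshelve. all: by end_near. Qed.

(** One exponent condition per term: the typical excess of all pieces, the crude excess of the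
    exceptional ones, and the closing segment. *)
Lemma scale_cost (a b b' eta' M1 Cd : R) : 0 <= a -> 0 <= b -> 0 <= M1 -> 0 <= Cd ->
  eta + a < b' -> eta' + (1 - eta) * b < b' -> eta < b' ->
  \forall K \near +oo, forall m L k, scale K m L -> 0 <= k <= 2 * K `^ eta' ->
    m * L `^ a + k * M1 * L `^ b + Cd * (m + 1) <= K `^ b'.
Proof.
move=> a0 b0 M10 Cd0 h1 h2 h3; near=> K => m L k KL /andP[k0 k1].
have K1 : 1 <= K by near: K; exact: near_ge.
have K0 : 0 < K by rewrite (lt_le_trans ltr01).
have g1 : 6 * K `^ (eta + a) <= K `^ b' by near: K; exact: near_powR_lt.
have g2 : (6 * M1) * K `^ (eta' + (1 - eta) * b) <= K `^ b'.
  by near: K; exact: near_powR_lt.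
have g3 : (9 * Cd) * K `^ eta <= K `^ b' by near: K; exact: near_powR_lt.
have [L0 _ _ LK _] := scale_bounds K1 KL.
have h4 := ler_wpM2l Cd0 (scale_m1 K1 KL).
have h5 : m * L `^ a <= 2 * K `^ (eta + a).
  rewrite powR_add// mulrA; apply: ler_pM; rewrite ?powR_ge0//.
    by case: KL => /(le_trans (powR_ge0 _ _)).
    by case: KL.
  by apply: ge0_ler_powR; rewrite ?nnegrE// ltW.
have h6 : k * M1 * L `^ b <= 2 * M1 * K `^ (eta' + (1 - eta) * b).
  rewrite powR_add// mulrA; apply: ler_pM; rewrite ?mulr_ge0 ?powR_ge0//.
    by rewrite mulrAC ler_wpM2r.
  exact: (scale_powL b0 K1 KL).
move: g1 g2 g3 h4 h5 h6.
by move: (K `^ b') (K `^ _) (K `^ _) (K `^ _) (m * _) (k * M1 * _) => x y z t y' z'; lra.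
Unshelve. all: by end_near. Qed.

(** Since [eta < (1 - eta) * e], the base is eventually at most [expR (- 1)], so the first term is
    at most [expR (- k)]. The strict inequalities on [th'] absorb the factor [m] and the halving of
    the two terms. *)
Lemma scale_prob (e th eta' th' : R) : 0 < e -> 0 < th' -> 0 <= th ->
  eta < (1 - eta) * e -> th' < eta' -> th' < (1 - eta) * th ->
  \forall K \near +oo, forall m L (k : nat), scale K m L -> K `^ eta' <= k%:R ->
    (m * (4 * L `^ (- e))) ^+ k + m * expR (- L `^ th) <= expR (- K `^ th').
Proof.
move=> e0 th'0 th0 h1 h2 h3; near=> K => m L k KL Kk.
have K1 : 1 <= K by near: K; exact: near_ge.
have K0 : 0 < K by rewrite (lt_le_trans ltr01).
have g1 : (8 * 2 `^ e * expR 1) * K `^ eta <= K `^ ((1 - eta) * e).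
  by near: K; exact: near_powR_lt.
have g2 : 2 * K `^ th' <= K `^ eta' by near: K; exact: near_powR_lt.
have g3 : (2 * 2 `^ th) * K `^ th' <= K `^ ((1 - eta) * th).
  by near: K; exact: near_powR_lt.
have h4 : 4 * K `^ eta <= expR (K `^ th') by near: K; exact: near_expR.
have h5 : 1 <= K `^ th' by rewrite -(powRr0 K) ler_powR// ltW.
have [L0 _ _ LK _] := scale_bounds K1 KL; have [m1 m2 _] := KL.
have m0 : 0 <= m by exact: le_trans (powR_ge0 _ _) m1.
have two : 2 <= expR 1 :> R by exact: expR_ge1Dx.
rewrite [leRHS](_ : _ = 2^-1 * expR (- K `^ th') + 2^-1 * expR (- K `^ th')); last first.
  by move: (expR _) => x; field.
apply: lerD.
  apply: (@le_trans _ _ (expR (- 1) ^+ k)).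
    apply: lerXn2r; rewrite ?nnegrE ?expR_ge0 ?mulr_ge0 ?powR_ge0//.
    rewrite powRN expRN -[leRHS]mul1r ler_pdivlMr ?expR_gt0// mulrA.
    rewrite mulrAC ler_pdivrMr ?powR_gt0// mul1r.
    have h6 := scale_powL_ge (ltW e0) K1 KL.
    have t0 : 0 < 2 `^ e :> R by exact: powR_gt0.
    rewrite -(ler_pM2l t0); apply: le_trans _ h6; apply: le_trans _ g1.
    apply: (@le_trans _ _ (2 `^ e * (2 * K `^ eta * 4 * expR 1))).
      by rewrite ler_pM2l// ler_pM2r ?expR_gt0// ler_pM2r.
    by rewrite le_eqVlt; apply/orP; left; apply/eqP; ring.
  rewrite -expRM_natl mulrN1; apply: (@le_trans _ _ (expR (- 1 - K `^ th'))).
    by rewrite ler_expR; lra.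
  rewrite expRD; apply: ler_wpM2r; first exact: expR_ge0.
  by rewrite expRN lef_pV2 ?posrE ?expR_gt0.
have h7 := scale_powL_ge th0 K1 KL.
have t0 : 0 < 2 `^ th :> R by exact: powR_gt0.
have h8 : 2 * K `^ th' <= L `^ th.
  by rewrite -(ler_pM2l t0) mulrCA mulrA (le_trans g3).
apply: (@le_trans _ _ (m * expR (- K `^ th' - K `^ th'))).
  by rewrite ler_wpM2l// ler_expR; lra.
rewrite expRD mulrA; apply: ler_wpM2r; first exact: expR_ge0.
rewrite expRN ler_pdivrMr ?expR_gt0//; lra.
Unshelve. all: by end_near. Qed.

End scales.

(** * From typical pieces to stretched exponential tails *)

Section pieces.
Context (R : realType) (d : nat) (disp : measure_display).
Context (Omega : measurableType disp) (P : probability Omega R).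
Variable tau : edge d -> {RV P >-> R}.
Hypothesis indep : mutually_independent tau.
Hypothesis ident : identically_distributed tau.
Variable C : R.
Hypothesis C_gt0 : 0 < C.
Hypothesis tau_ge0 : forall e w, 0 <= tau e w.
Hypothesis tau_le : forall e, P [set w | tau e w <= C] = 1%E.
Variables (mu : 'rV[R]_d -> R) (mu_tc : time_constant tau mu).
Variable ut : 'I_d -> 'rV[R]_d.
Hypothesis onb : orthonormal_basis ut.
Variable o : 'I_d.
Hypothesis o0 : o = 0%N :> nat.
Variable l0 : R.
Hypothesis l0_gt0 : 0 < l0.

Variable u : 'rV[R]_d.
Hypothesis u_unit : enorm u = 1.
Variables (delta chi1 chi : R) (n0 : nat).
Hypothesis delta_gt0 : 0 < delta.
Hypothesis chi1_gt0 : 0 < chi1.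
Hypothesis chi1_chi : chi1 < chi.
Hypothesis chi_lt1 : chi < 1.
Hypothesis admissible : chi_upper_admissible tau mu u ut delta n0 chi1.

(** The hyperplane condition makes [l0] common to all directions. Normalizing [v] moves it by at
    most its distance to [u], hence [delta / 2]; the bound [2^-1] keeps [v] away from 0. *)
Definition near_dir : set 'rV[R]_d :=
  [set v | dot (ut o) v = l0 /\ enorm (v - u) < Num.min (delta / 2) (2^-1)].

Definition region (v : 'rV[R]_d) (rho L : R) : set 'rV[int]_d :=
  lat (Cyl ut v `[- (rho * L), rho * L] (L `^ ((chi + 1) / 2))).

Lemma near_dir_enorm v : near_dir v -> 2^-1 <= enorm v <= 2.
Proof.
move=> [_]; rewrite lt_min => /andP[_ vu].
have := enormD (v - u) u; have := enormD (u - v) v; rewrite !subrK.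
by rewrite -(enormN (u - v)) opprB u_unit; lra.
Qed.

Lemma near_dir_n1 v : near_dir v -> n1 v <= d%:R * 2.
Proof.
move=> /near_dir_enorm/andP[_ v2]; apply: le_trans (n1_le_enorm _) _.
by rewrite ler_wpM2l.
Qed.

Lemma near_dir_direction v L : 0 < L -> near_dir v ->
  enorm (u - (enorm (L *: v))^-1 *: (L *: v)) < delta.
Proof.
move=> L0 Vv; have /andP[v1 _] := near_dir_enorm Vv.
case: Vv => _; rewrite lt_min => /andP[vu _].
have v0 : 0 < enorm v by rewrite (lt_le_trans _ v1)// invr_gt0.
rewrite enormZ gtr0_norm// scalerA (_ : _^-1 * L = (enorm v)^-1); last first.
  by rewrite invfM mulrAC mulVf ?mul1r ?gt_eqF.
rewrite -(subrK v u) -addrA; apply: le_lt_trans (enormD _ _) _.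
rewrite -(enormN (u - v)) opprB.
suff : enorm (v - (enorm v)^-1 *: v) <= enorm (v - u) by lra.
rewrite -[X in enorm (X - _)]scale1r -scalerBl enormZ -[X in _ * X]gtr0_norm//.
rewrite -normrM mulrBl mul1r mulVf ?gt_eqF// -u_unit ler_norml.
have := enormD (v - u) u; have := enormD (u - v) v; rewrite !subrK.
by rewrite -(enormN (u - v)) opprB; lra.
Qed.

(** With [a = (1 + chi1) / 2], the width exponent of the admissible cylinder, at least about
    [L^(1 - a)] slabs fit in the length, and the bound on [e] says [e < 1 - a]. The constant 4 is 2
    from [enorm x <= 2 * L] in the Markov bound and 1 for each end. *)
Lemma typical_piece (e : R) : 0 < e -> e < (1 - chi1) / 2 ->
  exists2 rho, 2 <= rho & \forall L \near +oo, forall v, near_dir v ->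
  pr tau (~` [set t | connects t (region v rho L) 0 (floor_pt (L *: v))
     (L * mu v + L `^ (chi1 + e))]) <= 4 * L `^ (- e).
Proof.
move=> e0 e1.
pose a := (1 + chi1) / 2.
have a_gt0 : 0 < a by have := chi1_gt0; rewrite /a; lra.
have a_chi : a < (chi + 1) / 2 by have := chi1_chi; rewrite /a; lra.
have a_lt1 : a < 1 by have := chi1_chi; have := chi_lt1; rewrite /a; lra.
have a_e : a - 1 < - e by rewrite /a; lra.
have D20 : 0 <= d%:R * 2 :> R by rewrite mulr_ge0.
have [c [W0 [c0 W01 stray]]] :=
  pr_stray indep ident C_gt0 tau_ge0 tau_le mu_tc onb o0 l0_gt0 D20.
have [B B0 muB] := mu_le (proj1 mu_tc).
(* [M] bounds the allowed time per unit of [L]. In [rho], the term [M / c] makes the slab crossings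
   outlast it, the 1 beside it pays for rounding [k] down, and the leading 2 serves the later
   iteration. *)
pose M := B * (d%:R * 2) + 1.
have M0 : 0 < M by rewrite ltr_wpDl// mulr_ge0// ltW.
pose rho := 2 + 2 * (1 + M / c) / l0.
have rho2 : 2 <= rho.
  by rewrite lerDl divr_ge0 ?(ltW l0_gt0)// mulr_ge0// addr_ge0// divr_ge0// ltW.
have rhol0 : 1 + M / c <= rho * l0 / 2.
  have -> : rho * l0 / 2 = l0 + (1 + M / c).
    by rewrite /rho; field; rewrite !lt0r_neq0.
  by rewrite lerDr ltW.
exists rho => //.
near=> L => v Vv.
have L1 : 1 <= L by near: L; exact: near_ge.
have L0 : 0 < L by lra.
have Ln0 : 2 * n0%:R <= L by near: L; exact: near_ge.
have LW0 : 2 * W0 <= L `^ a by near: L; exact: near_powR.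
have Lchi : 2 * L `^ a <= L `^ ((chi + 1) / 2).
  by near: L; exact: near_powR_lt.
have La1 : 2 * L `^ a <= L.
  rewrite -[leRHS]powRr1; last exact: ltW.
  by near: L; exact: near_powR_lt.
have Lae : 2 * L `^ (a - 1) <= L `^ (- e).
  by near: L; exact: near_powR_lt.
have Vn := near_dir_n1 Vv; have [vl _] := Vv.
have /andP[v1 v2] := near_dir_enorm Vv.
pose x := L *: v; pose h := enorm x `^ a.
have xE : enorm x = L * enorm v by rewrite enormZ gtr0_norm.
have xlo : L <= 2 * enorm x.
  by rewrite xE mulrCA ler_peMr ?(ltW L0)// -ler_pdivrMl// mulr1.
have xhi : enorm x <= 2 * L by rewrite xE mulrC ler_pM2r.
have a0 : 0 <= a by exact: ltW.
have a1 : a <= 1 by exact: ltW.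
have x0 : 0 <= enorm x by exact: enorm_ge0.
have two_pow b : 0 <= b -> b <= 1 -> (2 : R) `^ b <= 2.
  by move=> b0 b1; apply: ler1_powR => //; rewrite ler1n.
have hhi : h <= 2 * L `^ a.
  apply: (@le_trans _ _ ((2 * L) `^ a)).
    by apply: ge0_ler_powR => //; rewrite nnegrE// mulr_ge0// ltW.
  by rewrite powRM ?(ltW L0)// ler_wpM2r ?powR_ge0// two_pow.
have hlo : W0 <= h.
  rewrite -(@ler_pM2l _ 2)//; apply: le_trans LW0 _.
  apply: (@le_trans _ _ ((2 * enorm x) `^ a)).
    by apply: ge0_ler_powR => //; rewrite nnegrE ?mulr_ge0// ltW.
  by rewrite powRM// ler_wpM2r ?powR_ge0// two_pow.
have h0 : 0 < h by rewrite (lt_le_trans _ hlo)// (lt_le_trans ltr01).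
(* The end at axial distance [rho * L] has height [rho * L * l0], so [2 * k] slabs of thickness [h]
   fit below it. *)
pose k := Num.truncn (rho * L * l0 / (2 * h)).
have rL0 : 0 <= rho * L * l0 by rewrite !mulr_ge0 ?(ltW L0) ?(ltW l0_gt0)//; lra.
have /andP[klo khi] : k%:R <= rho * L * l0 / (2 * h) < k.+1%:R.
  by apply: truncn_itv; rewrite divr_ge0// mulr_ge0// ltW.
have {}klo : (2 * k)%:R * h <= rho * L * l0.
  by move: klo; rewrite ler_pdivlMr ?mulr_gt0// natrM mulrCA mulrA.
have {}khi : rho * L * l0 < k.+1%:R * (2 * h).
  by move: khi; rewrite ltr_pdivrMr ?mulr_gt0.
set s := L `^ (chi1 + e).
have sL : s <= L by apply: ler1_powR => //; lra.
have muv : mu v + 1 <= M.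
  rewrite lerD2r; apply: le_trans (muB _) _; rewrite ler_pM2l//.
  exact: le_trans (norm_le_n1 v) Vn.
have time_k : L * mu v + s < c * h * k%:R.
  have hL : h <= L := le_trans hhi La1.
  have h1 : L * (1 + M / c) <= L * (rho * l0 / 2) by rewrite ler_pM2l.
  have h2 : L * (M / c) < h * k%:R.
    rewrite -natr1 in khi; lra.
  rewrite -mulrA -ltr_pdivrMl//; apply: le_lt_trans h2.
  rewrite mulrC [leRHS]mulrA ler_pM2r ?invr_gt0//.
  apply: (@le_trans _ _ (L * (mu v + 1))); last by rewrite ler_pM2l.
  by rewrite mulrDr mulr1 lerD2l.
have quarter : 4^-1 ^+ k <= L `^ (- e).
  apply: le_trans (quarter_exp_le _ _) _; apply: le_trans Lae.
  rewrite powR_add// powRN powRr1 ?(ltW L0)// mulrA ler_pdivlMr// mulrC ler_pdivrMr//.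
  have h3 : 2 <= rho * l0 by have := divr_ge0 (ltW M0) (ltW c0); lra.
  have h4 : L * 2 <= L * (rho * l0) by rewrite ler_pM2l.
  have : k.+1%:R * h <= k.+1%:R * (2 * L `^ a) by rewrite ler_pM2l.
  lra.
pose A := lat (Cyl ut v setT h).
set E := ~` _.
pose E1 := ~` [set t : edge d -> R | connects t A 0 (floor_pt x) (mu x + s)].
pose St sg := [set t : edge d -> R |
  fast (stray_paths ut o A sg ((2 * k)%:R * h)) (L * mu v + s) t].
have mSt sg : sig setT (St sg) by apply: sig_fast.
have mE1 : sig setT E1 by apply: sigC; exact: sigT_connects.
have mE : sig setT E by apply: sigC; exact: sigT_connects.
have muxE : mu x = L * mu v by rewrite (muZ (proj1 mu_tc)) gtr0_norm.
have pE1 : pr tau E1 <= 2 * L `^ (- e).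
  have s0 : 0 < s by exact: powR_gt0.
  have xn0 : n0%:R <= enorm x by rewrite -(@ler_pM2l _ 2)//; exact: le_trans Ln0 xlo.
  have [_ adm] := admissible.
  have := adm x xn0 (near_dir_direction L0 Vv); rewrite (Cyl_scale _ _ _ L0).
  move=> /(le_trans (pr_excess tau mu (Cyl ut v setT h) x s0)); rewrite lee_fin => H.
  rewrite -(ler_pM2l s0); apply: le_trans H _.
  rewrite mulrCA -powR_add// addrK.
  apply: (@le_trans _ _ ((2 * L) `^ chi1)).
    by apply: ge0_ler_powR; rewrite ?nnegrE ?(ltW chi1_gt0)// mulr_ge0// ltW.
  rewrite powRM ?(ltW L0)// ler_wpM2r ?powR_ge0// two_pow ?(ltW chi1_gt0)//.
  by rewrite (le_trans (ltW chi1_chi))// ltW.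
have pSt sg : `|sg| = 1 -> pr tau (St sg) <= L `^ (- e).
  by move=> sg1; apply: le_trans (stray _ _ _ _ _ hlo vl Vn sg1 time_k) quarter.
apply: (@le_trans _ _ (pr tau (E1 `|` (St 1 `|` St (-1))))).
  apply: (pr_le tau_ge0 tau_le) => //; first by apply: sigU => //; exact: sigU.
  move=> t tC nE; have [|cA] := pselect (E1 t); first by left.
  right; have {cA} /connectsP[p [pe pA ps]] : connects t A 0 (floor_pt x) (mu x + s).
    by apply: contrapT.
  have [y yp ny] : exists2 y, y \in path_vertices 0 p & ~ region v rho L y.
    apply: contrapT => H; apply: nE; apply/connectsP; exists p; split=> //.
      by move=> y yp; apply: contrapT => ny; apply: H; exists y.
    by rewrite -muxE.
  have Ay := pA y yp.
  have /(CylP onb o0 l0_gt0 vl)[_ ytr] := Ay.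
  (* The cylinder [A] is narrower than [region v rho L], so [y] can only have left through an
     end. *)
  have far : rho * L < `|ax ut o l0 (to_real R y)|.
    rewrite ltNge; apply/negP => yL; apply: ny.
    apply/(CylP onb o0 l0_gt0 vl); split; first by rewrite /= in_itv /= -ler_norml.
    by move=> i i0; apply: le_trans (ytr i i0) _; exact: le_trans hhi Lchi.
  have [p1 [p2 [pE p1e]]] := mem_vertices_split yp.
  have p1A z : z \in path_vertices 0 p1 -> A z.
    by move=> zp; apply: pA; rewrite pE mem_vertices_cat zp.
  have p1t : path_time t 0 p1 <= L * mu v + s.
    rewrite -muxE; apply: le_trans ps; rewrite pE path_time_cat lerDl.
    exact: path_time_ge0 tC.
  have stray_sg sg : rho * L * l0 <= sg * dot (ut o) (to_real R y) -> St sg t.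
    move=> yl; exists (0, p1) => //; split => //=.
    by rewrite p1e; exact: le_trans klo yl.
  have dotE : dot (ut o) (to_real R y) = ax ut o l0 (to_real R y) * l0.
    by rewrite /ax divfK ?gt_eqF.
  move: far; rewrite lter_normr => /orP[far|far]; [left|right]; apply: stray_sg.
    by rewrite mul1r dotE ler_pM2r// ltW.
  by rewrite mulN1r dotE -mulNr ler_pM2r// ltW.
apply: le_trans (pr_setU _ _ _) _ => //; first exact: sigU.
apply: le_trans (lerD pE1 (pr_setU _ _ _)) _ => //.
have h1 : pr tau (St 1) <= L `^ (- e) by apply: pSt; rewrite normr1.
have h2 : pr tau (St (-1)) <= L `^ (- e) by apply: pSt; rewrite normrN1.
apply: le_trans (lerD (lexx _) (lerD h1 h2)) _.
by rewrite -mulr2n -[X in _ + X]mulr_natl -mulrDl -natrD.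
Unshelve. all: by end_near. Qed.

(* Bounds the oblique coordinates of the fractional part of a point. *)
Definition floor_slack : R := oblique_const l0 (d%:R * 2) * d%:R.

Lemma ax_le_l1 v w : near_dir v -> n1 w <= d%:R -> `|ax ut o l0 w| <= floor_slack.
Proof.
move=> Vv wd; apply: le_trans (ax_le onb o l0_gt0 (near_dir_n1 Vv) w) _.
by rewrite /floor_slack ler_pM2l// (lt_le_trans ltr01 (oblique_const_ge1 l0_gt0 (near_dir_n1 Vv))).
Qed.

Lemma tr_le_l1 v w i : near_dir v -> n1 w <= d%:R -> `|tr ut o l0 v i w| <= floor_slack.
Proof.
move=> Vv wd; apply: le_trans (tr_le onb o l0_gt0 (near_dir_n1 Vv) i w) _.
by rewrite /floor_slack ler_pM2l// (lt_le_trans ltr01 (oblique_const_ge1 l0_gt0 (near_dir_n1 Vv))).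
Qed.

Lemma regionP v rho L y : near_dir v -> region v rho L y <->
  `|ax ut o l0 (to_real R y)| <= rho * L /\
  forall i : 'I_d, (0 < i)%N -> `|tr ut o l0 v i (to_real R y)| <= L `^ ((chi + 1) / 2).
Proof.
move=> [vl _]; apply: (iff_trans (CylP onb o0 l0_gt0 vl _ _ _)).
by rewrite /= in_itv /= -ler_norml.
Qed.

(** * Chains of translated pieces in a fixed direction *)

Section direction.
Variables (v : 'rV[R]_d) (Vv : near_dir v).
Let vl : dot (ut o) v = l0 := proj1 Vv.
Let f L : 'rV[int]_d := floor_pt (L *: v).

Lemma to_real_f L : to_real R (f L) = L *: v - frac_pt (L *: v).
Proof. by rewrite /frac_pt opprB addrC subrK. Qed.

Lemma ax_f L : ax ut o l0 (to_real R (f L)) = L - ax ut o l0 (frac_pt (L *: v)).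
Proof. by rewrite to_real_f axD axN axZ (ax_v l0_gt0 vl) mulr1. Qed.

Lemma tr_f L i : tr ut o l0 v i (to_real R (f L)) = - tr ut o l0 v i (frac_pt (L *: v)).
Proof. by rewrite to_real_f trD trN trZ (tr_v l0_gt0 vl) mulr0 add0r. Qed.

Definition shifted rho L i : set 'rV[int]_d := [set z | region v rho L (z - f L *+ i)].

Lemma ax_shift L i z : ax ut o l0 (to_real R (z - f L *+ i)) =
  ax ut o l0 (to_real R z) - i%:R * (L - ax ut o l0 (frac_pt (L *: v))).
Proof. by rewrite to_realD to_realN to_realMn axD axN axZ ax_f. Qed.

Lemma tr_shift L n z i : tr ut o l0 v i (to_real R (z - f L *+ n)) =
  tr ut o l0 v i (to_real R z) + n%:R * tr ut o l0 v i (frac_pt (L *: v)).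
Proof. by rewrite to_realD to_realN to_realMn trD trN trZ tr_f mulrN opprK. Qed.

Lemma frac_ax L : `|ax ut o l0 (frac_pt (L *: v))| <= floor_slack.
Proof. exact: ax_le_l1 Vv (n1_frac _). Qed.

Lemma frac_tr L i : `|tr ut o l0 v i (frac_pt (L *: v))| <= floor_slack.
Proof. exact: tr_le_l1 Vv (n1_frac _). Qed.

Lemma floor_slack_ge0 : 0 <= floor_slack.
Proof. exact: le_trans (normr_ge0 _) (frac_ax 0). Qed.

(** Once [floor_slack] is at most [L / 2], each translation advances by at least [L / 2], while two
    points of one piece are at most [2 rho L] apart along the axis. *)
Lemma shifted_disjoint rho L i j z : 2 * floor_slack <= L -> 0 < L ->
  shifted rho L i z -> shifted rho L j z -> j%:R - i%:R <= 4 * rho.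
Proof.
move=> GL L0 /(regionP _ _ _ Vv)[hi _] /(regionP _ _ _ Vv)[hj _].
move: hi hj; rewrite !ax_shift; set g := ax _ _ _ (frac_pt _); set y := ax _ _ _ _.
have gG : `|g| <= floor_slack by exact: frac_ax.
rewrite !ler_norml => /andP[hi1 hi2] /andP[hj1 hj2].
rewrite leNgt; apply/negP => ij.
have g2 : 2^-1 * L <= L - g.
  by move: gG; rewrite ler_norml => /andP[_]; lra.
have r0 : 0 <= rho * L by lra.
have r1 : 0 <= rho by rewrite -(pmulr_lge0 _ L0).
have ij0 : 0 <= j%:R - i%:R :> R by lra.
have h1 : (j%:R - i%:R) * (L - g) <= 2 * (rho * L) by lra.
have h2 : (j%:R - i%:R) * (2^-1 * L) <= (j%:R - i%:R) * (L - g) by rewrite ler_wpM2l.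
have h3 : 4 * rho * L < (j%:R - i%:R) * L by rewrite ltr_pM2r.
lra.
Qed.

Section chain.
Variables (rho L : R) (m : nat).
Hypothesis L0 : 0 < L.
Let K := m%:R * L.
Hypothesis long : K + rho * L + 2 * floor_slack * m.+1%:R <= 2 * K.
Hypothesis wide : L `^ ((chi + 1) / 2) + 2 * floor_slack * m.+1%:R <= K `^ ((chi + 1) / 2).

Lemma m_bounds i : (i <= m)%N -> i%:R * L <= K /\ i%:R * floor_slack <= m%:R * floor_slack.
Proof.
by move=> im; split; apply: ler_wpM2r; rewrite ?ler_nat ?floor_slack_ge0// ltW.
Qed.

Lemma norm_axE (i : nat) (a g b r : R) : `|a| <= b ->
  `|g| <= floor_slack -> i%:R * L + b + i%:R * floor_slack <= r ->
  `|a + i%:R * (L - g)| <= r.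
Proof.
move=> ab gG h; apply: le_trans (ler_normD _ _) _; rewrite normrM ger0_norm//.
apply: le_trans h; rewrite addrC -addrA [b + _]addrC addrA; apply: lerD => //.
rewrite -mulrDr ler_wpM2l//; apply: le_trans (ler_normB _ _) _.
by rewrite gtr0_norm// lerD2l.
Qed.

Lemma shifted_sub i : (i <= m)%N -> shifted rho L i `<=` region v 2 K.
Proof.
move=> im z /(regionP _ _ _ Vv)[hax htr]; have [iL iG] := m_bounds im.
have G0 := floor_slack_ge0; have mG : 0 <= m%:R * floor_slack by rewrite mulr_ge0.
have mS : m.+1%:R = m%:R + 1 :> R by rewrite natr1.
apply/(regionP _ _ _ Vv); split.
  have -> : ax ut o l0 (to_real R z) = ax ut o l0 (to_real R (z - f L *+ i)) +
      i%:R * (L - ax ut o l0 (frac_pt (L *: v))) by rewrite ax_shift subrK.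
  apply: norm_axE hax (frac_ax L) _; apply: le_trans long.
  by rewrite mS mulrDr; lra.
move=> k k0; have := htr k k0; rewrite tr_shift => h.
rewrite -[X in `|X|](addrK (i%:R * tr ut o l0 v k (frac_pt (L *: v)))).
apply: le_trans (ler_normB _ _) _; apply: le_trans wide; apply: lerD => //.
rewrite normrM ger0_norm//; apply: (@le_trans _ _ (i%:R * floor_slack)).
  by rewrite ler_wpM2l// frac_tr.
by rewrite mS; lra.
Qed.

(** The [m] steps [f L] miss the endpoint by [m] fractional parts of [L *: v] and one of
    [K *: v]. *)
Lemma last_gap : (l1 (f K - f L *+ m) <= d * m.+1)%N.
Proof.
rewrite -(ler_nat R) -n1_to_real to_realD to_realN to_realMn (to_real_f K) (to_real_f L).
rewrite scalerBr scalerA -/K.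
rewrite [X in n1 X](_ : _ = m%:R *: frac_pt (L *: v) - frac_pt (K *: v)); last first.
  by move: (frac_pt (K *: v)) (m%:R *: frac_pt _) => b c; rewrite opprB addrC addrA subrK.
apply: le_trans (n1D _ _) _; rewrite n1N n1Z ger0_norm//.
rewrite mulnS natrD addrC; apply: lerD; first exact: n1_frac.
by rewrite natrM mulrC ler_wpM2r// n1_frac.
Qed.

Hypothesis rho0 : 0 <= rho.

Lemma last_sub z : (l1 (z - f L *+ m) <= d * m.+1)%N -> region v 2 K z.
Proof.
rewrite -(ler_nat R) natrM -n1_to_real => zn.
have G0 := floor_slack_ge0; have mG : 0 <= m%:R * floor_slack by rewrite mulr_ge0.
have mS : m.+1%:R = m%:R + 1 :> R by rewrite natr1.
have n1v := near_dir_n1 Vv.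
have geo0 := lt_le_trans ltr01 (oblique_const_ge1 l0_gt0 n1v).
have zG : oblique_const l0 (d%:R * 2) * n1 (to_real R (z - f L *+ m)) <= floor_slack * m.+1%:R.
  by rewrite /floor_slack -mulrA ler_pM2l.
have rL : 0 <= rho * L by rewrite mulr_ge0// ltW.
apply/(regionP _ _ _ Vv); split.
  have hax := le_trans (ax_le onb o l0_gt0 n1v (to_real R (z - f L *+ m))) zG.
  have -> : ax ut o l0 (to_real R z) = ax ut o l0 (to_real R (z - f L *+ m)) +
      m%:R * (L - ax ut o l0 (frac_pt (L *: v))) by rewrite ax_shift subrK.
  apply: norm_axE hax (frac_ax L) _; apply: le_trans long; rewrite mS mulrDr -/K.
  by move: rL mG G0; move: (rho * L) (m%:R * floor_slack) floor_slack => a b c; lra.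
move=> k k0; have := le_trans (tr_le onb o l0_gt0 n1v k (to_real R (z - f L *+ m))) zG.
rewrite tr_shift => h.
rewrite -[X in `|X|](addrK (m%:R * tr ut o l0 v k (frac_pt (L *: v)))).
apply: le_trans (ler_normB _ _) _; apply: le_trans wide.
have -> : 2 * floor_slack * m.+1%:R = floor_slack * m.+1%:R + floor_slack * m.+1%:R.
  by rewrite -mulrDl -mulr2n mulr_natl.
rewrite addrA; apply: lerD; first by apply: le_trans h _; rewrite lerDr powR_ge0.
rewrite normrM ger0_norm// mulrC; apply: ler_pM => //; first exact: frac_tr.
by rewrite ler_nat.
Qed.

Lemma pr_not_connects_shift A x a b s :
  pr tau (~` [set t | connects t [set z | A (z - x)] (a + x) (b + x) s]) =
  pr tau (~` [set t | connects t A a b s]).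
Proof.
rewrite -(pr_reindex indep ident (shift_edgeK x) (sigC (sigT_connects A a b s))).
by congr (pr tau _); apply/seteqP; split=> t nc c; apply: nc; apply/connects_shift.
Qed.

(** [s1] is the typical excess of a piece and [s2] the crude one; pieces whose indices differ by
    more than [M] are disjoint. *)
Variables (k M : nat) (s1 s2 s p q : R).
Hypothesis k0 : (0 < k)%N.
Hypothesis rhoM : 4 * rho < M.+1%:R.
Hypothesis GL : 2 * floor_slack <= L.
Hypotheses (s10 : 0 <= s1) (s20 : 0 <= s2).
Hypothesis cost : m%:R * s1 + (k * M.+1)%:R * s2 + C * (d * m.+1)%:R <= s.
Hypothesis pP : pr tau (~` [set t | connects t (region v rho L) 0 (f L) (L * mu v + s1)]) <= p.
Hypothesis qP : pr tau (~` [set t | connects t (region v rho L) 0 (f L) (L * mu v + s2)]) <= q.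

Let good i e := [set t : edge d -> R |
  connects t (shifted rho L i) (f L *+ i) (f L *+ i.+1) (L * mu v + e)].

Let pr_good i e : pr tau (~` good i e) =
  pr tau (~` [set t | connects t (region v rho L) 0 (f L) (L * mu v + e)]).
Proof. by rewrite -(pr_not_connects_shift _ (f L *+ i)) add0r -mulrS. Qed.

(** Bad pieces still connect within the crude excess, so the chain survives and only its cost
    changes. The threshold [k * M.+1] is what the pigeonhole principle needs to find [k] bad pieces
    in one residue class. *)
Lemma few_bad_connects t : bounded_weights C t -> (forall i : 'I_m, good i s2 t) ->
  (#|finset (fun i : 'I_m => ~~ `[< good i s1 t >])| < k * M.+1)%N ->
  connects t (region v 2 K) 0 (f K) (K * mu v + s).
Proof.
move=> tC ok; set bad := finset _ => few.
pose c (i : nat) : R := L * mu v + (if `[< good i s1 t >] then s1 else s2).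
have A0 : region v 2 K (f L *+ 0).
  have z0 : to_real R (f L *+ 0) = 0 *: 0 by rewrite to_realMn !scale0r.
  apply/(regionP _ _ _ Vv); rewrite z0; split=> [|i i0].
    by rewrite axZ mul0r normr0 !mulr_ge0// ltW.
  by rewrite trZ mul0r normr0 powR_ge0.
have main : connects t (region v 2 K) 0 (f L *+ m) (\sum_(i < m) c i).
  rewrite -[0](mulr0n (f L)); apply: (connects_chain (z := fun i => f L *+ i)) => // i im.
  rewrite /c; case: asboolP => [g|_].
    exact: connects_sub (shifted_sub (ltnW im)) (lexx _) g.
  exact: connects_sub (shifted_sub (ltnW im)) (lexx _) (ok (Ordinal im)).
have last : connects t (region v 2 K) (f L *+ m) (f K) (C * (d * m.+1)%:R).
  apply: connects_sub (connects_line (A := region v 2 K) (ltW C_gt0) tC _) => //.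
    by rewrite ler_pM2l// ler_nat last_gap.
  by move=> z zl; apply: last_sub; apply: leq_trans zl last_gap.
apply: connects_sub (connects_cat main last) => //.
rewrite /c big_split /= sumr_const card_ord -addrA; apply: lerD.
  by rewrite /K -[leLHS]mulr_natl mulrA.
apply: le_trans cost; rewrite lerD2r.
apply: (@le_trans _ _ (m%:R * s1 + #|bad|%:R * s2)); last first.
  by rewrite lerD2l ler_wpM2r// ler_nat ltnW.
rewrite -[m in m%:R * _]card_ord -!sum1_card !natr_sum !mulr_suml.
rewrite [X in _ + X]big_mkcond -big_split /=; apply: ler_sum => i _.
by rewrite inE; case: asboolP => _ /=; rewrite !mul1r ?addr0 ?lerDr.
Qed.

(* [q] bounds the probability that a given piece exceeds the crude excess [s2];
   the first term accounts for [k] independent pieces exceeding [s1]. *)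
Lemma amplify : pr tau (~` [set t | connects t (region v 2 K) 0 (f K) (K * mu v + s)])
  <= (m%:R * p) ^+ k + m%:R * q.
Proof.
set E := ~` _; pose U := ~` \bigcap_(i in [set` enum 'I_m]) good i s2.
have mgood i e : sig setT (good i e) by exact: sigT_connects.
have mE : sig setT E by apply: sigC; exact: sigT_connects.
have mU : sig setT U by apply: sigC; apply: sig_bigI => i _.
have mbd := @sig_bounded_weights R d C.
(* [U] collects the crude failures and is paid for by the union bound; on [E'] every piece connects
   at least crudely. *)
pose E' := E `&` bounded_weights C `&` ~` U.
have mE' : sig setT E' by apply: sigI; [exact: sigI|exact: sigC].
have p0 : 0 <= p by exact: le_trans (pr_ge0 _ _) pP.
apply: (@le_trans _ _ (pr tau (E' `|` U))).
  apply: (pr_le tau_ge0 tau_le) => //; first exact: sigU.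
  by move=> t tC Et; have [|] := pselect (U t); [right|left].
apply: le_trans (pr_setU _ mE' mU) _; apply: lerD; last first.
  have -> : m = size (enum 'I_m) by rewrite size_enum_ord.
  apply: (pr_union_bound (F := fun i : 'I_m => ~` good i s2)) => //.
  - by move=> i _; exact: sigC.
  - by move=> i _; rewrite pr_good.
  - by rewrite /U setC_bigcap.
pose B (i : 'I_m) := ~` good i s1.
pose Q (S : {set 'I_m}) := [forall i in S, forall j in S, (i %% M.+1 == j %% M.+1)%N].
apply: le_trans (@pr_subset_tail _ _ _ _ _ _ m k B Q _ p p0 mE' _ _ _) _.
- by move=> i; exact: sigC.
- move=> S Sk /forall_inP QS; rewrite (_ : [set` S] = [set` enum S]); last first.
    by apply/seteqP; split=> i; rewrite /= mem_enum.
  have sizeS : size (enum S) = k by rewrite -cardE.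
  rewrite -[in leRHS]sizeS; apply: (pr_indep_seq indep (S := fun j : 'I_m =>
    inside (shifted rho L j))).
  + exact: enum_uniq.
  + move=> i j e; rewrite !mem_enum => iS jS [ei _] [ej _]; apply/val_inj => /=.
    have /forall_inP/(_ j jS)/eqP mij := QS i iS.
    have H (a b : 'I_m) : (a < b)%N -> (a %% M.+1 = b %% M.+1)%N ->
        shifted rho L a e.1 -> shifted rho L b e.1 -> False.
      move=> ab mab ea eb; have := shifted_disjoint GL L0 ea eb.
      rewrite -natrB 1?ltnW// leNgt (lt_le_trans rhoM)// ler_nat.
      apply: dvdn_leq; first by rewrite subn_gt0.
      by rewrite -eqn_mod_dvd ?mab// ltnW.
    by case: (ltngtP i j) => // [/H|/H] []; rewrite ?mij.
  + by move=> i _; apply: sigC; exact: sig_connects.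
  + by move=> i _; rewrite pr_good.
- move=> t [[Et tC] nU].
  have ok : forall i : 'I_m, good i s2 t.
    by move: nU => /contrapT H i; apply: H; rewrite /= mem_enum.
  pose bad := finset (fun i : 'I_m => ~~ `[< good i s1 t >]).
  have [few|many] := ltnP #|bad| (k * M.+1).
    by exfalso; apply: Et; exact: few_bad_connects.
  have [S [SA Sk SM]] := same_residue_subset k0 many; exists S; split=> //.
    by apply/forall_inP => i iS; apply/forall_inP => j jS; rewrite (SM i j).
  move=> i iS; have := fintype.subsetP SA i iS.
  by rewrite inE => /asboolPn.
- rewrite exprMn ler_wpM2r ?exprn_ge0// -natrX ler_nat bin_le_exp//.
Qed.

End chain.

End direction.

(** * Improving the exponent of the excess by iteration *)

Definition tail_bound (rho b : R) := exists2 th, 0 < th & \forall L \near +oo,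
  forall v, near_dir v ->
  pr tau (~` [set t | connects t (region v rho L) 0 (floor_pt (L *: v)) (L * mu v + L `^ b)])
    <= expR (- L `^ th).

Lemma tail_bound_mono rho rho' b : rho <= rho' -> tail_bound rho b -> tail_bound rho' b.
Proof.
move=> rr [th th0 H]; exists th => //; near=> L => v Vv.
have L0 : 0 <= L by near: L; exact: near_ge.
apply: le_trans (_ : _ <= pr tau (~` [set t | connects t (region v rho L) 0
    (floor_pt (L *: v)) (L * mu v + L `^ b)])) _; last first.
  by move: v Vv; near: L.
apply: pr_mono; do ?by apply: sigC; exact: sigT_connects.
move=> t nc c; apply: nc; apply: connects_sub c => // y.
move=> /(regionP _ _ _ Vv)[h1 h2]; apply/(regionP _ _ _ Vv).
by split=> //; apply: le_trans h1 _; rewrite ler_wpM2r.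
Unshelve. all: by end_near. Qed.

Lemma near_straight_chain : \forall K \near +oo, forall v, near_dir v ->
  forall t, bounded_weights C t ->
  connects t (region v 2 K) 0 (floor_pt (K *: v)) (K * mu v + K `^ 2).
Proof.
pose H := floor_slack.
near=> K => v Vv t tC.
have K1 : 1 <= K by near: K; exact: near_ge.
have K0 : 0 < K by rewrite (lt_le_trans ltr01).
have HK : 5 * H <= K by near: K; exact: near_ge.
have Hw : 5 * H <= K `^ ((chi + 1) / 2).
  by near: K; apply: near_powR; rewrite divr_gt0// addr_gt0// (lt_trans chi1_gt0).
have CK : 8 * C * d%:R <= K by near: K; exact: near_ge.
have [vl _] := Vv.
have muv : 0 <= mu v by exact: (mu_ge0 (proj1 mu_tc)).
(* Since [m > K], consecutive points of the segment are within [2 d] in [n1], and rounding both adds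
   [2 d]: this is the [4 * d] below. One more fractional part gives the [5 * H] above. *)
pose m := (Num.truncn K).+1.
have /andP[mK Km] : (Num.truncn K)%:R <= K < m%:R by apply: truncn_itv; exact: ltW.
have m0 : 0 < m%:R :> R by rewrite ltr0n.
have m2 : m%:R <= 2 * K by rewrite /m -natr1; lra.
pose f (i : nat) : 'rV[int]_d := floor_pt ((i%:R / m%:R * K) *: v).
have nearby (i : nat) z : (i <= m)%N -> (l1 (z - f i) <= 4 * d)%N -> region v 2 K z.
  move=> im; rewrite -(ler_nat R) -n1_to_real => zn.
  set x := (i%:R / m%:R * K) *: v.
  have zE : to_real R z = x + (to_real R (z - f i) - frac_pt x).
    rewrite to_realD to_realN /frac_pt -[floor_pt x]/(f i).
    move: (to_real R z) (to_real R (f i)) => a c.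
    by rewrite opprB [RHS]addrC -addrA !subrK.
  have n1v := near_dir_n1 Vv.
  have xfr := n1_frac x.
  have n1w : n1 (to_real R (z - f i) - frac_pt x) <= 5 * d%:R.
    apply: le_trans (n1D _ _) _; rewrite n1N natrM in zn *.
    by rewrite (_ : 5 * _ = 4 * d%:R + d%:R) ?lerD//; ring.
  have geo0 := lt_le_trans ltr01 (oblique_const_ge1 l0_gt0 n1v).
  have gw : oblique_const l0 (d%:R * 2) * n1 (to_real R (z - f i) - frac_pt x) <= 5 * H.
    by rewrite /H /floor_slack mulrCA ler_pM2l.
  apply/(regionP _ _ _ Vv); rewrite zE; split=> [|j j0].
    rewrite axD /x axZ (ax_v l0_gt0 vl) mulr1; apply: le_trans (ler_normD _ _) _.
    rewrite (_ : 2 * K = K + K); last by rewrite mulr_natl mulr2n.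
    apply: lerD; last exact: le_trans (ax_le onb o l0_gt0 n1v _) (le_trans gw HK).
    rewrite normrM (gtr0_norm K0) ler_piMl ?(ltW K0)// ger0_norm ?divr_ge0//.
    by rewrite ler_pdivrMr// mul1r ler_nat.
  rewrite trD /x trZ (tr_v l0_gt0 vl) mulr0 add0r.
  exact: le_trans (tr_le onb o l0_gt0 n1v j _) (le_trans gw Hw).
have f0 : f 0 = 0 by apply/rowP => i; rewrite !mxE !mul0r floor0.
have fm : f m = floor_pt (K *: v) by rewrite /f divff ?mul1r// gt_eqF.
have step i : (l1 (f i.+1 - f i) <= 4 * d)%N.
  rewrite -(ler_nat R) -n1_to_real to_realD to_realN.
  set x := (i%:R / m%:R * K) *: v; set y := (i.+1%:R / m%:R * K) *: v.
  have fE z : to_real R (floor_pt z) = z - frac_pt z by rewrite /frac_pt opprB addrC subrK.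
  rewrite /f -/x -/y !fE (_ : _ - _ = (K / m%:R) *: v + (frac_pt x - frac_pt y)); last first.
    have -> : (K / m%:R) *: v = y - x.
      by rewrite -scalerBl -natr1; congr (_ *: _); field; rewrite gt_eqF.
    by move: (frac_pt x) (frac_pt y) => a c; rewrite opprB [a - x]addrC addrACA [- c + a]addrC.
  apply: le_trans (n1D _ _) _.
  rewrite natrM (_ : 4 * d%:R = 2 * d%:R + (d%:R + d%:R)); last by ring.
  apply: lerD.
    rewrite n1Z ger0_norm ?divr_ge0 ?(ltW K0)// mulrC -[leRHS]mulr1.
    apply: ler_pM; rewrite ?n1_ge0 ?divr_ge0 ?(ltW K0)//.
      by rewrite mulrC; exact: (near_dir_n1 Vv).
    by rewrite ler_pdivrMr// mul1r ltW.
  by apply: le_trans (n1D _ _) _; rewrite n1N lerD ?n1_frac.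
have main : connects t (region v 2 K) (f 0) (f m) (\sum_(i < m) C * (4 * d)%:R).
  apply: (connects_chain (z := f) (s := fun=> C * (4 * d)%:R)).
    apply: (nearby 0%N) => //; rewrite subrr (_ : l1 0 = 0%N)// /l1 big1// => i _.
    by rewrite mxE.
  move=> i im; apply: connects_sub (connects_line (A := region v 2 K) (ltW C_gt0) tC _) => //.
    by rewrite ler_pM2l// ler_nat.
  by move=> z zl; apply: (nearby i); [exact: ltnW|exact: leq_trans zl (step i)].
rewrite -f0 -fm; apply: connects_sub main => //.
rewrite sumr_const card_ord powR_mulrn ?(ltW K0)// expr2 -[leLHS]add0r.
apply: lerD; first by rewrite mulr_ge0// ltW.
have h1 : K * (8 * C * d%:R) <= K * K by rewrite ler_pM2l.
apply: le_trans h1; rewrite -[leLHS]mulr_natl natrM.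
have h2 : 0 <= C * (4 * d%:R) by rewrite !mulr_ge0// ltW.
by apply: le_trans (ler_wpM2r h2 m2) _; rewrite le_eqVlt; apply/orP; left; apply/eqP; ring.
Unshelve. all: by end_near. Qed.

Lemma tail_base : tail_bound 2 2.
Proof.
(* The event has probability 0 for large [K], so any exponent will do. *)
exists 1 => //; near=> K => v Vv.
apply: le_trans (_ : 0 <= _); last exact: expR_ge0.
have E0 : pr tau set0 = 0 by rewrite /pr preimage_set0 measure0.
rewrite -E0; apply: (pr_le tau_ge0 tau_le).
- apply: sigC; exact: sigT_connects.
- exact: sigma_algebra0.
- move=> t tC; apply; move: v Vv t tC; near: K; exact: near_straight_chain.
Unshelve. all: by end_near. Qed.

Lemma tail_step (e rho b : R) : 0 < e -> e <= (chi - chi1) / 4 -> 2 <= rho ->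
  (\forall L \near +oo, forall v, near_dir v ->
  pr tau (~` [set t | connects t (region v rho L) 0 (floor_pt (L *: v))
     (L * mu v + L `^ (chi1 + e))]) <= 4 * L `^ (- e)) ->
  chi <= b -> tail_bound rho b -> tail_bound 2 (Num.max chi (b * (1 - e / 4 / 2))).
Proof.
move=> e0 e1 rho2 typical chib [th th0 Hb].
(* Taking [e / 4] keeps [eta + chi1 + e] below [chi] and [m * L^(- e)] small. As [chi <= b], [eta']
   is below [b * eta / 2], the room between [(1 - eta) * b] and [(1 - eta / 2) * b]. *)
set b' := Num.max _ _; pose eta := e / 4; pose eta' := chi * eta / 4.
have chi0 : 0 < chi by exact: lt_trans chi1_chi.
have e_lt : 4 * e < 1 by have := chi_lt1; have := chi1_gt0; lra.
have eta0 : 0 < eta by rewrite divr_gt0.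
have eta1 : eta < 1 by rewrite /eta; lra.
have eta'0 : 0 < eta' by rewrite !mulr_gt0// invr_gt0.
have b'chi : chi <= b' by rewrite le_max lexx.
have b'b : b * (1 - eta / 2) <= b' by rewrite le_max lexx orbT.
have c1 : eta + (chi1 + e) < b' by apply: lt_le_trans b'chi; rewrite /eta; have := chi1_chi; lra.
have eta_chi : eta < chi by rewrite /eta; have := chi1_gt0; lra.
have c3 : eta < b' by apply: lt_le_trans b'chi.
have c2 : eta' + (1 - eta) * b < b'.
  apply: lt_le_trans b'b.
  have h1 : chi * eta <= b * eta by rewrite ler_pM2r.
  have h2 : 0 < chi * eta by rewrite mulr_gt0.
  by rewrite /eta'; lra.
have c4 : eta < (1 - eta) * e.
  have : eta * e <= eta * 1 by rewrite ler_pM2l//; lra.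
  by rewrite /eta; lra.
have c5 : eta < (chi + 1) / 2 by lra.
(* Halving makes both inequalities strict. The exponent shrinks at every round, which is harmless
   over finitely many rounds. *)
pose th' := Num.min eta' ((1 - eta) * th) / 2.
have mn0 : 0 < Num.min eta' ((1 - eta) * th) by rewrite lt_min eta'0 mulr_gt0// subr_gt0.
have th'0 : 0 < th' by rewrite divr_gt0.
have th'lt : th' < Num.min eta' ((1 - eta) * th) by rewrite /th'; lra.
have /andP[c6 c7] : (th' < eta') && (th' < (1 - eta) * th) by rewrite -lt_min.
have [M1 HM1] := near_extract typical; have [M2 HM2] := near_extract Hb.
have rho0 : 0 <= rho by lra.
pose H := floor_slack; have H0 : 0 <= H.
  rewrite /H /floor_slack mulr_ge0// /oblique_const addr_ge0// divr_ge0 ?(ltW l0_gt0)//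
    addr_ge0// mulr_ge0//.
pose M := Num.truncn (4 * rho).
have rhoM : 4 * rho < M.+1%:R.
  by have /andP[] := truncn_itv (mulr_ge0 (ler0n R 4) rho0).
have b0 : 0 <= b by lra.
have a0 : 0 <= chi1 + e by have := chi1_gt0; lra.
have Cd0 : 0 <= C * d%:R by rewrite mulr_ge0// ltW.
exists th' => //; near=> K => v Vv.
have K1 : 1 <= K by near: K; exact: near_ge.
have long : forall m L, scale eta K m L -> K + rho * L + 2 * H * (m + 1) <= 2 * K.
  by near: K; exact: scale_long.
have wide : forall m L, scale eta K m L ->
    L `^ ((chi + 1) / 2) + 2 * H * (m + 1) <= K `^ ((chi + 1) / 2).
  by near: K; exact: scale_wide.
have cost : forall m L k, scale eta K m L -> 0 <= k <= 2 * K `^ eta' ->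
    m * L `^ (chi1 + e) + k * M.+1%:R * L `^ b + C * d%:R * (m + 1) <= K `^ b'.
  by near: K; exact: scale_cost.
have prob : forall m L (k : nat), scale eta K m L -> K `^ eta' <= k%:R ->
    (m * (4 * L `^ (- e))) ^+ k + m * expR (- L `^ th) <= expR (- K `^ th').
  by near: K; apply: scale_prob => //; exact: ltW.
have KM1 : 2 * (M1 + 1) <= K `^ (1 - eta) by near: K; apply: near_powR; rewrite subr_gt0.
have KM2 : 2 * (M2 + 1) <= K `^ (1 - eta) by near: K; apply: near_powR; rewrite subr_gt0.
have KH : 2 * (2 * H) <= K `^ (1 - eta) by near: K; apply: near_powR; rewrite subr_gt0.
(* Rounding up a number that is at least 1 at most doubles it, which is the factor 2 in [scale]. *)
pose m := (Num.truncn (K `^ eta)).+1; pose k := (Num.truncn (K `^ eta')).+1.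
have trS (x : R) : 1 <= x -> x <= (Num.truncn x).+1%:R /\ (Num.truncn x).+1%:R <= 2 * x.
  move=> x1; have /andP[h1 h2] := truncn_itv (le_trans ler01 x1).
  by split; [exact: ltW|rewrite -natr1 mulr_natl mulr2n lerD].
have p1 (x : R) : 0 <= x -> 1 <= K `^ x by move=> x0; rewrite -(powRr0 K) ler_powR.
have [m1 m2] := trS _ (p1 _ (ltW eta0)); have [k1 k2] := trS _ (p1 _ (ltW eta'0)).
pose L := K / m%:R.
have mL : m%:R * L = K by rewrite /L mulrC divfK// pnatr_eq0.
have KL : scale eta K m%:R L by split.
have [L0 KL2 _ _ _] := scale_bounds eta0 K1 KL.
have big (N : R) : 2 * N <= K `^ (1 - eta) -> N <= L.
  by move=> /le_trans/(_ KL2); rewrite ler_pM2l.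
have LM1 : M1 < L by apply: lt_le_trans (big _ KM1); rewrite ltrDl.
have LM2 : M2 < L by apply: lt_le_trans (big _ KM2); rewrite ltrDl.
have GL : 2 * H <= L by exact: big.
have k0 : (0 < k)%N by [].
have long' : m%:R * L + rho * L + 2 * H * m.+1%:R <= 2 * (m%:R * L).
  by rewrite mL -[m.+1%:R]natr1; exact: long.
have wide' : L `^ ((chi + 1) / 2) + 2 * H * m.+1%:R <= (m%:R * L) `^ ((chi + 1) / 2).
  by rewrite mL -[m.+1%:R]natr1; exact: wide.
have cost' : m%:R * L `^ (chi1 + e) + (k * M.+1)%:R * L `^ b + C * (d * m.+1)%:R <= K `^ b'.
  rewrite [(k * _)%:R]natrM [(d * _)%:R]natrM -[m.+1%:R]natr1 mulrA.
  by apply: cost => //; rewrite ler0n k2.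
have := amplify Vv L0 long' wide'
  rho0 k0 rhoM GL (powR_ge0 _ _) (powR_ge0 _ _) cost' (HM1 L LM1 v Vv) (HM2 L LM2 v Vv).
by rewrite mL => /le_trans; apply; exact: prob.
Unshelve. all: by end_near. Qed.

Lemma tail_chi : tail_bound 2 chi.
Proof.
pose e := Num.min ((chi - chi1) / 4) ((1 - chi1) / 4).
have x1 : 0 < (chi - chi1) / 4 by rewrite divr_gt0// subr_gt0.
have x2 : 0 < (1 - chi1) / 4 by rewrite divr_gt0// subr_gt0 (lt_trans chi1_chi).
have e0 : 0 < e by rewrite lt_min x1 x2.
have e1 : e <= (chi - chi1) / 4 by rewrite ge_min lexx.
have e2 : e < (1 - chi1) / 2.
  apply: (@le_lt_trans _ _ ((1 - chi1) / 4)); first by rewrite ge_min lexx orbT.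
  lra.
have [rho rho2 typical] := typical_piece e0 e2.
pose r := 1 - e / 4 / 2.
have r1 : r < 1 by rewrite ltrBlDr ltrDl !divr_gt0.
have r0 : 0 < r.
  by have := chi_lt1; have := chi1_gt0; rewrite /r; lra.
have chi0 : 0 < chi by exact: lt_trans chi1_chi.
(* The maximum with [chi] is stable because [chi * r <= chi]: only the second term shrinks, until it
   falls below [chi]. *)
have iter k : tail_bound 2 (Num.max chi (2 * r ^+ k)).
  elim: k => [|k IH].
    rewrite expr0 mulr1 max_r; last by rewrite (le_trans (ltW chi_lt1))// ler1n.
    exact: tail_base.
  have chib : chi <= Num.max chi (2 * r ^+ k) by rewrite le_max lexx.
  have := tail_step e0 e1 rho2 typical chib (tail_bound_mono rho2 IH).
  congr tail_bound; rewrite -/r maxr_pMl ?(ltW r0)// maxA [Num.max chi (chi * r)]max_l.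
    by rewrite exprSr mulrA.
  by rewrite ler_piMr ?ltW.
have [k kchi] : exists k, 2 * r ^+ k <= chi.
  have r_norm : `|r| < 1 by rewrite gtr0_norm.
  have /cvgrPdist_lt/(_ (chi / 2)) := cvg_expr r_norm.
  rewrite divr_gt0// => /(_ isT)[k _ /(_ k (leqnn k))] /=.
  rewrite sub0r normrN ger0_norm ?exprn_ge0 ?(ltW r0)// ltr_pdivlMr// mulrC.
  by move=> /ltW; exists k.
by have := iter k; rewrite max_l.
Qed.

End pieces.

(** * Extracting an admissible exponent from the double limit *)

Section chi_upper.
Context (R : realType) (d : nat) (disp : measure_display).
Context (Omega : measurableType disp) (P : probability Omega R).
Variable tau : edge d -> {RV P >-> R}.

(** Raising [n] or lowering [delta] leaves fewer constraints on an exponent, so both limits are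
    infima of monotone families, and an infimum below [b] yields explicit witnesses. *)
Lemma admissible_lt_chi_upper mu u ut (b : R) :
  (chi_upper tau mu u ut < b%:E)%E -> exists delta n chi1,
    [/\ 0 < delta, chi1 < b & chi_upper_admissible tau mu u ut delta n chi1].
Proof.
rewrite /chi_upper.
pose f delta n := ereal_inf (EFin @` chi_upper_admissible tau mu u ut delta n).
have f_n delta : {homo f delta : n m / (n <= m)%N >-> (m <= n)%E}.
  move=> n m nm; apply: ereal_inf_le_tmp => _ [c [c0 Hc] <-]; exists c => //.
  split=> // x xm xd; apply: Hc => //; apply: le_trans xm; by rewrite ler_nat.
have g_n delta : f delta n @[n --> \oo] --> ereal_inf (range (f delta)).
  by apply: ereal_nonincreasing_cvgn => n m /f_n.
have gE delta : limn (f delta) = ereal_inf (range (f delta)).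
  by apply/cvg_lim => //; exact: g_n.
pose g delta := ereal_inf (range (f delta)).
have g_nd : {in `]0, 1[ &, {homo g : x y / x <= y >-> (x <= y)%E}}.
  move=> x y _ _ xy; apply: le_ereal_inf_tmp => _ [n _ <-].
  apply: (@le_trans _ _ (f x n)); first by apply: ereal_inf_lbound; exists n.
  apply: ereal_inf_le_tmp => _ [c [c0 Hc] <-]; exists c => //.
  by split=> // z zn zd; apply: Hc => //; exact: lt_le_trans zd xy.
rewrite (_ : (fun delta => _) = g); last by apply/funext => delta; exact: gE.
have b01 : (BRight (0 : R) < BLeft 1)%O by rewrite bnd_simp.
have /cvg_lim -> // := @nondecreasing_at_right_cvge R g 0 (BLeft 1) b01 g_nd.
  move=> /ereal_inf_lt[_ [delta d01 <-]] /ereal_inf_lt[_ [n _ <-]].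
  move=> /ereal_inf_lt[_ [c Hc <-]]; rewrite lte_fin => cb.
  exists delta, n, c; split=> //.
  by move: d01; rewrite /= in_itv /= => /andP[].
Qed.

End chi_upper.

Lemma dot_transverse_span (R : realType) d (ut : 'I_d -> 'rV[R]_d) (o : 'I_d) t :
  orthonormal_basis ut -> o = 0%N :> nat -> t \in transverse_span ut -> dot (ut o) t = 0.
Proof.
move=> onb o0; rewrite /transverse_span; set s := [seq _ | _ <- _ & _] => ts.
rewrite (coord_span (X := in_tuple s) ts) dot_sumr big1// => i _.
rewrite dotZr; have : (in_tuple s)`_i \in s by exact: mem_nth.
case/mapP => j; rewrite mem_filter => /andP[j0 _] ->.
rewrite onb (_ : o == j = false) ?mulr0//; apply/negP => /eqP oj.
by rewrite -oj o0 in j0.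
Qed.

Theorem theorem1p2 (R : realType) (d : nat) (d_ge2 : (2 <= d)%N)
  (disp : measure_display) (Omega : measurableType disp)
  (P : probability Omega R)
  (tau : edge d -> {RV P >-> R})
  (tau_ge0 : forall e w, 0 <= tau e w)
  (tau_indep : mutually_independent tau)
  (tau_ident : identically_distributed tau)
  (tau_nondeg : forall e, nondegenerate_rv (tau e))
  (tau_subcritical :
     forall e, (P [set w | tau e w = 0%R] < (p_c R d)%:E)%E)
  (tau_bounded :
     exists2 C : R, 0 < C & forall e, P [set w | tau e w <= C] = 1%E)
  (mu : 'rV[R]_d -> R) (mu_time_constant : time_constant tau mu)
  (u : 'rV[R]_d) (u_unit : enorm u = 1)
  (H : set 'rV[R]_d)
  (H_support :
     supporting_hyperplane [set mu u *: z | z in [set z | mu z <= 1]] u H)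
  (ut : 'I_d -> 'rV[R]_d) (ut_frame : tilted_frame u H ut)
  (finite_curvature :
     exists2 C : R, 0 < C &
       forall t : 'rV[R]_d, t \in transverse_span ut ->
         mu (u + t) - mu u <= C * enorm t ^+ 2)
  (eps : R) (eps_gt0 : 0 < eps)
  (chibar : R) (chibarE : chibar%:E = (chi_upper tau mu u ut + eps%:E)%E)
  (chibar_lt1 : chibar < 1) :
  exists theta0 c0 : R, [/\ 0 < theta0, 0 < c0 &
    exists K0 : R, forall K : R, K0 <= K ->
      forall (a : R) (v : 'rV[R]_d),
        chibar <= a <= 1 ->
        H v ->
        enorm (K *: v - K *: u) < K `^ ((chibar + 1 + c0) / 2) ->
        let A := Cyl ut v `[- (2 * K), 2 * K] (K `^ ((a + 1) / 2)) in
        (P [set w | ((K * mu v + K `^ a)%R%:E < T_in tau A 0%R (K *: v)%R w)%E]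
         <= (expR (- (K `^ (theta0 * (a - chibar)))))%R%:E)%E].
Proof.
have d_gt0 : (0 < d)%N by exact: leq_trans d_ge2.
pose o : 'I_d := Ordinal d_gt0; have o0 : o = 0%N :> nat by [].
have [onb HE ut_u] := ut_frame.
have [C C_gt0 tau_le] := tau_bounded.
pose l0 := dot (ut o) u; have l0_gt0 : 0 < l0 by exact: ut_u.
have [delta [n0 [chi1 [delta_gt0 chi1_lt adm]]]] : exists delta n chi1,
    [/\ 0 < delta, chi1 < chibar & chi_upper_admissible tau mu u ut delta n chi1].
  (* The equation defining [chibar] excludes infinite values, so adding [eps] gives a strict
     inequality. *)
  apply: admissible_lt_chi_upper; rewrite chibarE.
  move: chibarE; case: (chi_upper tau mu u ut) => [x| |] //= _.
  by rewrite -EFinD lte_fin ltrDl.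
have chi1_gt0 : 0 < chi1 by case: adm.
have [th th0 tail] := tail_chi tau_indep tau_ident C_gt0 tau_ge0 tau_le mu_time_constant onb o0
  l0_gt0 u_unit chi1_gt0 chi1_lt chibar_lt1 adm.
have chi_gt0 : 0 < 1 - chibar by rewrite subr_gt0.
(* As [a <= 1], this gives [theta0 * (a - chibar) <= th]. The choice of [c0] keeps the exponent in
   the condition on [v] below 1, so that [v - u] tends to 0 and [v] enters [near_dir]. *)
exists (th / (1 - chibar)), ((1 - chibar) / 2); split; rewrite ?divr_gt0//.
pose del := Num.min (delta / 2) 2^-1.
have del0 : 0 < del by rewrite lt_min divr_gt0//= invr_gt0.
have s1 : (chibar + 1 + (1 - chibar) / 2) / 2 < 1 by lra.
(* The threshold must not depend on [a] and [v], so both are quantified inside the neighborhood of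
   infinity. *)
suff /near_extract[M HM] : \forall K \near +oo, forall (a : R) (v : 'rV[R]_d),
    chibar <= a <= 1 -> H v ->
    enorm (K *: v - K *: u) < K `^ ((chibar + 1 + (1 - chibar) / 2) / 2) ->
    let A := Cyl ut v `[- (2 * K), 2 * K] (K `^ ((a + 1) / 2)) in
    (P [set w | ((K * mu v + K `^ a)%R%:E < T_in tau A 0%R (K *: v)%R w)%E]
     <= (expR (- (K `^ (th / (1 - chibar) * (a - chibar)))))%R%:E)%E.
  by exists (M + 1) => K MK; apply: HM; rewrite (lt_le_trans _ MK)// ltrDl.
near=> K => a v /andP[a1 a2] Hv Kv; cbv zeta; set A := Cyl _ _ _ _.
have K1 : 1 <= K by near: K; exact: near_ge.
have K0 : 0 < K by rewrite (lt_le_trans ltr01).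
have Vv : near_dir ut o l0 u delta v.
  split.
    move: Hv; rewrite -HE => -[t ts <-].
    by rewrite dotDr (dot_transverse_span onb o0 ts) addr0.
  move: Kv; rewrite -scalerBr enormZ gtr0_norm// => Kv.
  rewrite -(ltr_pM2l K0); apply: lt_le_trans Kv _.
  rewrite [leRHS]mulrC -ler_pdivrMl// -[leRHS]powRr1; last exact: ltW.
  by near: K; exact: near_powR_lt.
have bound : pr tau (~` [set t | connects t (region ut chibar v 2 K) 0 (floor_pt (K *: v))
    (K * mu v + K `^ chibar)]) <= expR (- K `^ th).
  by move: v Vv {Hv Kv A}; near: K.
apply: le_trans (P_lt_passage tau A 0 (K *: v) (K * mu v + K `^ a)) _.
rewrite lee_fin (_ : floor_pt 0 = 0); last by apply/rowP => i; rewrite !mxE floor0.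
apply: le_trans (_ : _ <= expR (- K `^ th)) _; last first.
  rewrite ler_expR lerN2 ler_powR// mulrAC ler_pdivrMr// ler_pM2l// lerD2r//.
apply: le_trans bound; apply: pr_mono.
- by apply: sigC; exact: sigT_connects.
- by apply: sigC; exact: sigT_connects.
move=> t nc c; apply: nc; apply: connects_sub c; last by rewrite lerD2l ler_powR.
have vl : dot (ut o) v = l0 by case: Vv.
move=> z /(CylP onb o0 l0_gt0 vl)[h1 h2]; apply/(CylP onb o0 l0_gt0 vl); split=> // i i0.
apply: le_trans (h2 i i0) _; rewrite ler_powR// ler_pM2r ?invr_gt0// lerD2r//.
Unshelve. all: by end_near. Qed.
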